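(* Let $f$ be a normal integrand on $\mathbb{R}^n\times\Omega$ such that $Ef$ is proper on $L^\infty$ and $\operatorname{dom}Ef\cap\mathcal N^\infty\neq\emptyset$. For $x^*\in\mathcal N^1$ define $\tilde\phi_{x^*}:L^\infty\to[-\infty,\infty]$ by $$\tilde\phi_{x^*}(z):=\inf_{x\in\mathcal N^\infty}E[f(x+z)-(x+z)\cdot x^*].$$ (i) If $x^*\in\mathcal N^1$ is such that $\tilde\phi_{x^*}$ is closed at the origin, then $$(Ef)^*(x^* )=\inf_{v\in\mathcal N^\perp}Ef^*(x^*+v).$$ (ii) If $\tilde\phi_{x^*}$ is subdifferentiable at the origin, then the infimum in (i) is attained. (iii) Let $x\in\mathcal N^\infty$. If $\tilde\phi_{x^*}$ is subdifferentiable at the origin for every $x^*\in\partial Ef(x)$, then $$\partial Ef(x)={}^aL^1(\partial f(x)).$$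
   Context: $(\Omega,\mathcal F,P)$ is a probability space with a filtration $(\mathcal F_t)_{t=0}^T$ (sub-$\sigma$-algebras of $\mathcal F$; $\mathcal F_T$ need not equal $\mathcal F$), and $n=n_0+\cdots+n_T$. $L^p:=L^p(\Omega,\mathcal F,P;\mathbb{R}^n)$ for $p\in\{0,1,\infty\}$. $\mathcal N=\{(x_t)_{t=0}^T \mid x_t\in L^0(\Omega,\mathcal F_t,P;\mathbb{R}^{n_t})\}$, $\mathcal N^\infty:=\mathcal N\cap L^\infty$, $\mathcal N^1:=\mathcal N\cap L^1$, $\mathcal N^\perp:=\{v\in L^1\mid E(z\cdot v)=0\ \forall z\in\mathcal N^\infty\}$. The adapted projection ${}^av$ of $v\in L^1$ is $({}^av)_t=E_tv_t$, with $E_t$ the conditional expectation given $\mathcal F_t$. A normal integrand is a function $f:\mathbb{R}^n\times\Omega\to[-\infty,\infty]$ such that $\omega\mapsto\{(\xi,\alpha)\mid f(\xi,\omega)\le\alpha\}$ is a closed-valued $\mathcal F$-measurable set-valued mapping. $Ef(x)$ is the expectation of $f(x):\omega\mapsto f(x(\omega),\omega)$, where the expectation of a measurable function is defined as $+\infty$ unless its positive part is integrable; $\operatorname{dom}Ef=\{x\mid Ef(x)<\infty\}$. ''$Ef$ is proper on $L^\infty$'' means $Ef>-\infty$ on $L^\infty$ and $Ef(z)<\infty$ for some $z\in L^\infty$. $f^*(\cdot,\omega)$ is the conjugate of $f(\cdot,\omega)$, and $Ef^*(v)$ is the expectation of $f^*(v)$. $(Ef)^*$ and $\partial Ef$ are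 with respect to the pairing $\langle x,x^*\rangle=E(x\cdot x^* )$ of $\mathcal N^\infty$ with $\mathcal N^1$: $(Ef)^*(x^* )=\sup_{x\in\mathcal N^\infty}\{E(x\cdot x^* )-Ef(x)\}$ and $\partial Ef(x)=\{x^*\in\mathcal N^1\mid Ef(x')\ge Ef(x)+E[(x'-x)\cdot x^*]\ \forall x'\in\mathcal N^\infty\}$. Here $\partial f(x)$ is the mapping $\omega\mapsto\partial f(x(\omega),\omega)$, the subdifferential (in the sense of convex analysis) of $f(\cdot,\omega)$ at $x(\omega)$. By convention every subdifferential at a point is empty unless the function is finite at that point. $L^1(\partial f(x))=\{v\in L^1\mid v(\omega)\in\partial f(x(\omega),\omega)\ \text{a.s.}\}$ and ${}^aL^1(\partial f(x))=\{{}^av\mid v\in L^1(\partial f(x))\}$. For $\tilde\phi_{x^*}$, closedness and subdifferentiability are with respect to the pairing $E(z\cdot v)$ of $L^\infty$ with $L^1$: a function $g:L^\infty\to[-\infty,\infty]$ is closed at the origin if $g(0)=g^{**}(0)$, where $g^{**}(z)=\sup_{v\in L^1}\{E(z\cdot v)-g^*(v)\}$, $g^*(v)=\sup_{z\in L^\infty}\{E(z\cdot v)-g(z)\}$; it is subdifferentiable at the origin if $g(0)$ is finite and there is $v\in L^1$ with $g(z)\ge g(0)+E(z\cdot v)$ for all $z\in L^\infty$. *)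

(* Defs.v *)
(* Library: MathComp-Analysis.

   Elements of the spaces L^p, N, ... are represented by functions
   x : Omega -> 'rV[R]_n rather than by classes modulo a.s. equality, and
   adapted processes by their F_t-measurable representatives.  All functionals
   below depend on their arguments only through their a.s. class. *)
From HB Require Import structures.
From mathcomp Require Export all_boot all_order all_algebra.
From mathcomp Require Export all_classical all_reals all_analysis.
Export Order.TTheory GRing.Theory Num.Theory.
Export numFieldNormedType.Exports.

Set Implicit Arguments.
Unset Strict Implicit.
Unset Printing Implicit Defensive.

Local Open Scope classical_set_scope.
Local Open Scope ring_scope.
Local Open Scope ereal_scope.

Definition dotp (R : realType) (n : nat) (u v : 'rV[R]_n) : R :=
  (\sum_(j < n) u ord0 j * v ord0 j)%R.

Definition conjugate (R : realType) (n : nat) (h : 'rV[R]_n -> \bar R)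
    (v : 'rV[R]_n) : \bar R :=
  ereal_sup [set (dotp xi v)%:E - h xi | xi in [set: 'rV[R]_n]].

Definition subdifferential (R : realType) (n : nat) (h : 'rV[R]_n -> \bar R)
    (xi : 'rV[R]_n) : set 'rV[R]_n :=
  [set v | h xi \is a fin_num /\
    forall xi', h xi + (dotp (xi' - xi)%R v)%:E <= h xi'].

Section Integrands.
Context (d : measure_display) (Omega : measurableType d) (R : realType).
Variables (P : probability Omega R) (n : nat).
Implicit Types (f : 'rV[R]_n -> Omega -> \bar R) (x z v : Omega -> 'rV[R]_n).
Implicit Types (g : (Omega -> 'rV[R]_n) -> \bar R).

(* A set-valued mapping S is measurable when {w | S w meets O} is measurable
   for every open set O. *)
Definition epigraph f (w : Omega) : set ('rV[R]_n * R) :=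
  [set p | f p.1 w <= p.2%:E].

Definition normal_integrand f : Prop :=
  (forall w, closed (epigraph f w)) /\
  (forall O : set ('rV[R]_n * R), open O ->
     measurable [set w | epigraph f w `&` O !=set0]).

Definition Eext (h : Omega -> \bar R) : \bar R :=
  if `[< P.-integrable [set: Omega] h^\+ >] then \int[P]_w h w else +oo.

Definition Ef f x : \bar R := Eext (fun w => f (x w) w).

Definition conj_integrand f : 'rV[R]_n -> Omega -> \bar R :=
  fun eta w => conjugate (f^~ w) eta.

Definition pairing x v : \bar R := 'E_P[fun w => dotp (x w) (v w)].

Definition Lvec (p : \bar R) : set (Omega -> 'rV[R]_n) :=
  [set x | forall j, (fun w => x w ord0 j) \in Lfun P p].

Definition proper_on_Linfty f : Prop :=
  (forall z, Lvec +oo z -> -oo < Ef f z) /\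
  (exists2 z, Lvec +oo z & Ef f z < +oo).

(* Functions g on L^infty are given by g : (Omega -> 'rV[R]_n) -> \bar R; only
   their values on L^infty are used. *)
Definition conj_Linfty g v : \bar R :=
  ereal_sup [set pairing z v - g z | z in Lvec +oo].

Definition biconj_Linfty g z : \bar R :=
  ereal_sup [set pairing z v - conj_Linfty g v | v in Lvec 1].

Definition closed_at_origin g : Prop := g (cst 0%R) = biconj_Linfty g (cst 0%R).

Definition subdifferentiable_at_origin g : Prop :=
  g (cst 0%R) \is a fin_num /\
  exists2 v, Lvec 1 v &
    forall z, Lvec +oo z -> g (cst 0%R) + pairing z v <= g z.

(* L^1(\partial f(x)) *)
Definition L1_subdiff f x : set (Omega -> 'rV[R]_n) :=
  [set v | Lvec 1 v /\ {ae P, forall w, subdifferential (f^~ w) (x w) (v w)}].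

End Integrands.

Section Adapted.
Context (d : measure_display) (Omega : measurableType d) (R : realType).
Variables (P : probability Omega R).

Definition sub_measurable (G : set (set Omega)) (X : Omega -> R) : Prop :=
  forall B : set R, measurable B -> G (X @^-1` B).

(* Y is a version of E[X | G]. *)
Definition cond_expectation (G : set (set Omega)) (X Y : Omega -> R) : Prop :=
  [/\ sub_measurable G Y, P.-integrable [set: Omega] (EFin \o Y) &
      forall A, G A -> \int[P]_(w in A) (Y w)%:E = \int[P]_(w in A) (X w)%:E].

Variable T : nat.

Definition filtration (F : 'I_T.+1 -> set (set Omega)) : Prop :=
  [/\ forall t, sigma_algebra [set: Omega] (F t),
      forall t, F t `<=` measurable &
      forall s t : 'I_T.+1, (s <= t)%N -> F s `<=` F t].

Variables (F : 'I_T.+1 -> set (set Omega)) (n_ : 'I_T.+1 -> nat).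

(* R^n with n = n_0 + ... + n_T; the component x_t is submxrow x t. *)
Local Notation n := (\sum_(t < T.+1) n_ t)%N.
Implicit Types (f : 'rV[R]_n -> Omega -> \bar R) (x z v : Omega -> 'rV[R]_n).

Definition component x (t : 'I_T.+1) (i : 'I_(n_ t)) : Omega -> R :=
  fun w => submxrow (x w) t ord0 i.
Arguments component x t i : clear implicits.

Definition adapted : set (Omega -> 'rV[R]_n) :=
  [set x | forall t i, sub_measurable (F t) (component x t i)].

Definition Ninfty : set (Omega -> 'rV[R]_n) := adapted `&` Lvec P +oo.

Definition N1 : set (Omega -> 'rV[R]_n) := adapted `&` Lvec P 1.

Definition Nperp : set (Omega -> 'rV[R]_n) :=
  [set v | Lvec P 1 v /\ forall z, Ninfty z -> pairing P z v = 0].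

(* u is a version of the adapted projection of v. *)
Definition adapted_projection v (u : Omega -> 'rV[R]_n) : Prop :=
  forall t i, cond_expectation (F t) (component v t i) (component u t i).

Definition Ef_conj f (xs : Omega -> 'rV[R]_n) : \bar R :=
  ereal_sup [set pairing P x xs - Ef P f x | x in Ninfty].

Definition Ef_subdiff f x : set (Omega -> 'rV[R]_n) :=
  [set xs | [/\ N1 xs, Ef P f x \is a fin_num &
    forall x', Ninfty x' ->
      Ef P f x + pairing P (fun w => x' w - x w)%R xs <= Ef P f x']].

(* ^a L^1(\partial f(x)) *)
Definition aL1_subdiff f x : set (Omega -> 'rV[R]_n) :=
  [set u | exists2 v, L1_subdiff P f x v & adapted_projection v u].

Definition phi_tilde f (xs z : Omega -> 'rV[R]_n) : \bar R :=
  ereal_inf [set Eext P (fun w =>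
      f (x w + z w)%R w - (dotp (x w + z w)%R (xs w))%:E) | x in Ninfty].

End Adapted.

Arguments Ninfty {d Omega R} P {T} F n_ _.
Arguments N1 {d Omega R} P {T} F n_ _.
Arguments Nperp {d Omega R} P {T} F n_ _.

(* Main.v *)
(* A successive-approximation argument (Kuratowski--Ryll-Nardzewski) gives
   countably many bounded measurable selections that are dense in the epigraphs
   of f(., w).  They make f(x) and f^*(v) measurable, and improving greedily on a
   point of dom Ef along them yields Rockafellar's interchange formula
   Ef^*(v) = sup_{z in L^infty} E(z.v) - Ef(z).  Substituting y = x + z, the
   conjugate of phi~_xs at v is then Ef^*(xs + v) if v is in N^perp and +oo
   otherwise, while phi~_xs(0) = -(Ef)^*(xs), so (i) and (ii) say that phi~_xs
   equals its biconjugate, resp. has a subgradient, at the origin.  For (iii), a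
   dual solution v attached to xs in the subdifferential of Ef at x turns
   Fenchel's inequality between f(x) and f^*(xs + v) into an equality of
   expectations, hence an a.s. equality. *)
Require Import Defs.
From mathcomp Require Import measurable_realfun ess_sup_inf.
From mathcomp Require Import ring lra.

Set Implicit Arguments.
Unset Strict Implicit.
Unset Printing Implicit Defensive.

Local Open Scope classical_set_scope.
Local Open Scope ring_scope.

(** * Measurable selections *)

(** The argument runs through epigraphs because [f(., w)] is only lower semicontinuous: its values
    along a dense set of arguments do not control it, whereas [dotp xi v - r] is continuous in the
    epigraph point [(xi, r)]. Epigraphs may be empty, so each selection is tied to a measurable
    event on which it is valid; it is confined to a ball of radius at most 1, so that competitors
    patched together from finitely many selections stay in L^infty, where properness bounds [Ef]
    away from [-oo]. The sigma-algebras [F t] need not contain the null sets, so changing an adapted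
    process on a null set could destroy adaptedness; truncation is therefore made by the value of
    the process. The inclusion in (iii) that the overview leaves out tests the pointwise subgradient
    inequality at a point of dom Ef in N^infty, which makes [Ef] finite at x, and then exchanges v
    with its adapted projection in pairings with adapted processes. *)

Definition least (Q : set nat) : nat :=
  if pselect (exists k, `[< Q k >]) is left e then ex_minn e else 0%N.

Lemma leastP (Q : set nat) : Q !=set0 -> Q (least Q).
Proof.
move=> [k Qk]; rewrite /least; case: pselect => [e|[]].
  by case: ex_minnP => m /asboolP.
by exists k; apply/asboolP.
Qed.

(** The second disjunct records the default [0] on the empty set. Membership tests alone thus
    determine the value, which gives measurability in a parameter. *)
Lemma leastE (Q : set nat) k : least Q = k <->
  (Q k /\ forall i, (i < k)%N -> ~ Q i) \/ (k = 0%N /\ forall i, ~ Q i).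
Proof.
rewrite /least; case: pselect => [e|ne].
  case: ex_minnP => m /asboolP Qm mm; split=> [<-|[[Qk km]|[_ /(_ m)]//]].
    left; split=> // i im Qi.
    by move/asboolP : Qi => /mm; rewrite leqNgt im.
  apply/eqP; rewrite eqn_leq; apply/andP; split; first exact/mm/asboolP.
  by rewrite leqNgt; apply/negP => /km.
split=> [<-|[[Qk _]|[-> //]]].
  by right; split=> // i Qi; apply: ne; exists i; apply/asboolP.
by exfalso; apply: ne; exists k; apply/asboolP.
Qed.

Lemma measurable_least d (Omega : measurableType d) (Q : Omega -> set nat) k :
  (forall i, measurable [set w | Q w i]) -> measurable [set w | least (Q w) =
    k].
Proof.
move=> mQ.
have -> : [set w | least (Q w) = k] =
    ([set w | Q w k] `&` \bigcap_(i in `I_k) ~` [set w | Q w i]) `|`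
    ([set _ | k = 0%N] `&` \bigcap_i ~` [set w | Q w i]).
  apply/seteqP; split => w /=.
    by move=> /leastE [[Qk km]|[k0 nQ]];
      [left; split=> // i; exact: km|right; split=> // i _; exact: nQ].
  by move=> [[Qk km]|[k0 nQ]]; apply/leastE;
    [left; split=> // i; exact: km|right; split=> // i; exact: nQ].
apply: measurableU; apply: measurableI.
- exact: mQ.
- by apply: bigcap_measurableType => i _; apply: measurableC.
- have [->|k0] := eqVneq k 0%N.
    by rewrite (_ : [set _ | _] = setT)//; apply/seteqP; split.
  rewrite (_ : [set _ | _] = set0)//.
  by apply/seteqP; split => // w /= /eqP; rewrite (negbTE k0).
- by apply: bigcapT_measurable => i; apply: measurableC.
Qed.

Section Selection.
Context (d : measure_display) (Omega : measurableType d) (R : realType).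
Context (E : pseudoMetricType R) (c : nat -> E) (S : Omega -> set E).

(* Histories are stored most recent index first. *)
Fixpoint history_set (s : seq nat) : set E :=
  if s is k :: s' then history_set s' `&` (ball (c k) (2 ^- size s'))°
  else setT.

Definition next_index (s : seq nat) (w : Omega) : nat :=
  least [set k | S w `&` history_set (k :: s) !=set0].

Fixpoint history (j : nat) (w : Omega) : seq nat :=
  if j is j'.+1 then next_index (history j' w) w :: history j' w else [::].

Definition approximant (j : nat) (w : Omega) : E :=
  c (head 0%N (history j.+1 w)).

Lemma size_history j w : size (history j w) = j.
Proof. by elim: j => //= j ->. Qed.

(** This is why [history_set] takes interiors: measurability of [S] is given against open sets, and
    balls of a pseudometric type need not be open. *)
Lemma open_history_set s : open (history_set s).
Proof.
by elim: s => [|k s IH] /=; [exact: openT|apply: openI => //;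
  exact: open_interior].
Qed.

(** Once the past [s] is fixed, the next index is a [least] over events that [S] meets an open set.
    Histories live in the countable type [seq nat], so level sets carry all the information. *)
Lemma measurable_history :
  (forall O, open O -> measurable [set w | S w `&` O !=set0]) ->
  forall j s, measurable [set w | history j w = s].
Proof.
move=> mS; elim=> [|j IH] s /=.
  case: s => [|k s]; first by rewrite (_ : [set _ | _] = setT)//; apply/seteqP;
    split.
  by rewrite (_ : [set _ | _] = set0)//; apply/seteqP; split.
case: s => [|k s]; first by rewrite (_ : [set _ | _] = set0)//; apply/seteqP;
  split.
rewrite (_ : [set _ | _] = [set w | history j w = s] `&`
                           [set w | next_index s w = k]).
  apply: measurableI => //; apply: measurable_least => i /=.
  by apply: mS; exact: (open_history_set (i :: s)).
by apply/seteqP; split => w /=; [move=> [<- <-]|move=> [-> ->]].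
Qed.

Lemma measurable_approximant (phi : E -> R) j :
  (forall O, open O -> measurable [set w | S w `&` O !=set0]) ->
  measurable_fun setT (fun w => phi (approximant j w)).
Proof.
move=> mS _ B mB; rewrite setTI.
rewrite (_ : _ @^-1` _ = \bigcup_(s : seq nat)
   ([set w | history j.+1 w = s] `&` [set _ | B (phi (c (head 0%N s)))])).
  apply: countable_bigcupT_measurable => // s.
  apply: measurableI; first exact: measurable_history.
  have [Bs|Bs] := pselect (B (phi (c (head 0%N s)))).
    by rewrite (_ : [set _ | _] = setT)//; apply/seteqP; split.
  by rewrite (_ : [set _ | _] = set0)//; apply/seteqP; split.
apply/seteqP; split => w /=; first by move=> Bw; exists (history j.+1 w).
by move=> [s _ [<-]].
Qed.

Hint Extern 0 (is_true (0 < 2 ^- _)) => by rewrite invr_gt0 exprn_gt0 : core.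

(** A centre within half the new radius of a surviving point [p] leaves a ball around [p] inside the
    new ball, so [p] survives in its interior. *)
Lemma history_set_meets w :
  (forall (p : E) (e : R), 0 < e -> exists k, ball (c k) e p) ->
  S w !=set0 -> forall j, S w `&` history_set (history j w) !=set0.
Proof.
move=> dense_c Sw; elim=> [|j [p [Sp hp]]] /=; first by rewrite setIT.
pose Q := [set k | S w `&` history_set (k :: history j w) !=set0].
suff /leastP : Q !=set0 by [].
have e0 : 0 < 2 ^- j / 2 :> R by rewrite divr_gt0.
have [k kp] := dense_c p _ e0.
exists k, p; split => //=; split => //.
rewrite size_history; apply/nbhs_ballP; exists (2 ^- j / 2) => //= q pq.
by rewrite (splitr (2 ^- j)); exact: ball_triangle kp pq.
Qed.

Lemma history_set_ball w i j p : (i < j)%N -> history_set (history j w) p ->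
  ball (approximant i w) (2 ^- i) p.
Proof.
elim: j => // j IH; rewrite ltnS leq_eqVlt => /predU1P[->|ij] /= [hp].
  by rewrite size_history => /nbhs_singleton.
by move=> _; exact: IH.
Qed.

(** Both approximants are near a common point of the later history set, and [2 ^- i + 2 ^- j] is at
    most [2 ^- i * 2]. *)
Lemma ball_approximant w i j :
  (forall (p : E) (e : R), 0 < e -> exists k, ball (c k) e p) ->
  S w !=set0 -> (i <= j)%N ->
  ball (approximant i w) (2 ^- i * 2) (approximant j w).
Proof.
move=> dense_c Sw ij.
have [p [_ hp]] := history_set_meets dense_c Sw j.+1.
have ip : ball (approximant i w) (2 ^- i) p by exact: history_set_ball hp.
have jp : ball (approximant j w) (2 ^- j) p by exact: history_set_ball hp.
apply: (@le_ball _ _ _ (2 ^- i + 2 ^- j)).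
  rewrite mulr_natr (mulr2n (2 ^- i)) lerD2l lef_pV2 ?posrE ?exprn_gt0//.
  by rewrite ler_weXn2l// ler1n.
by apply: ball_triangle ip _; exact: ball_sym.
Qed.

(** The approximants converge at an explicit rate, and the limit stays in the closed set [S w] since
    the approximant of index [j] is within [2 ^- j] of a point of it. Measurability is expressed
    through continuous real functions, so [E] carries no sigma-algebra. *)
Theorem measurable_selection :
  (forall (p : E) (e : R), 0 < e -> exists k, ball (c k) e p) ->
  (forall u : nat -> E,
    (forall i j, (i <= j)%N -> ball (u i) (2 ^- i * 2) (u j)) ->
    exists l : E, u @ \oo --> l) ->
  (forall O, open O -> measurable [set w | S w `&` O !=set0]) ->
  (forall w, S w !=set0) -> (forall w, closed (S w)) ->
  exists2 s : Omega -> E, (forall w, S w (s w)) &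
    forall phi : E -> R, continuous phi -> measurable_fun setT (phi \o s).
Proof.
move=> dense_c complete_E mS S0 cS.
have /choice[s us] : forall w, exists l : E, approximant^~ w @ \oo --> l.
  by move=> w; apply: complete_E => i j; exact: ball_approximant.
exists s => [w|phi cphi].
  apply: cS => U /nbhs_ballP[e/= e0 eU].
  have e20 : 0 < e / 2 by rewrite divr_gt0.
  have : \forall j \near \oo, ball (s w) (e / 2) (approximant j w).
    by apply: us; exact: nbhsx_ballx.
  move=> /(filterI (near_infty_natSinv_expn_lt (PosNum e20)))[j _ /(_ j (leqnn
    j))].
  rewrite /= div1r => -[je sj].
  have [p [Sp hp]] := history_set_meets dense_c (S0 w) j.+1.
  exists p; split => //; apply: eU; rewrite (splitr e);
    apply: ball_triangle sj _.
  exact: le_ball (ltW je) _ (history_set_ball (ltnSn j) hp).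
apply: (@measurable_fun_cvg _ _ _ _ (fun j => phi \o approximant j)) => [j|w _].
  exact: measurable_approximant.
by apply: continuous_cvg; [exact: cphi|exact: us].
Qed.
End Selection.

Lemma fast_cauchy_cvg (R : realType) (V : completePseudoMetricType R)
    (u : nat -> V) :
  (forall i j, (i <= j)%N -> ball (u i) (2 ^- i * 2) (u j)) ->
  exists l : V, u @ \oo --> l.
Proof.
move=> uP; apply/cvg_ex/cauchy_cvgP/cauchy_ballP => e e0.
(* Any two terms past [N] are joined through [u N] by two links of length [2 ^- N * 2], whence the
   quarter. *)
have e40 : 0 < e / 4 by rewrite divr_gt0.
have [N _ /(_ N (leqnn N))] := near_infty_natSinv_expn_lt (PosNum e40).
rewrite /= div1r => Ne.
exists (u @` [set i | (N <= i)%N], u @` [set i | (N <= i)%N]) => /=.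
  by split; exists N => //= i Ni; exists i.
move=> [_ _] [/= [i Ni <-] [j Nj <-]].
apply: (@le_ball _ _ _ (2 ^- N * 2 + 2 ^- N * 2)).
  rewrite -mulrDr -natrD; apply/ltW; rewrite -ltr_pdivlMr//.
apply: ball_triangle (uP _ _ Nj); apply: ball_sym; exact: uP.
Qed.

(** * Dense measurable selections of the epigraphs *)

Section Castaing.
Context (d : measure_display) (Omega : measurableType d) (R : realType).
Context (n : nat).
Local Notation E := ('rV[R]_n * R)%type.

Lemma fast_cauchy_cvg_pair (u : nat -> E) :
  (forall i j, (i <= j)%N -> ball (u i) (2 ^- i * 2) (u j)) ->
  exists l : E, u @ \oo --> l.
Proof.
move=> uP.
have [l1 ul1] : exists l : 'rV[R]_n, fst \o u @ \oo --> l.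
  by apply: fast_cauchy_cvg => i j ij; have [] := uP i j ij.
have [l2 ul2] : exists l : R, snd \o u @ \oo --> l.
  by apply: (@fast_cauchy_cvg R R) => i j ij; have [] := uP i j ij.
exists (l1, l2); rewrite (_ : u = fun k => ((u k).1, (u k).2)).
  exact: (@cvg_pair _ _ _ \oo (nbhs l1) (nbhs l2) _ _ _ (fst \o u) (snd \o u)).
by apply/funext => k; rewrite -surjective_pairing.
Qed.

Definition rat_point (k : nat) : E :=
  let q : 'rV[rat]_n * rat := odflt (0, 0) (unpickle k) in
  (map_mx ratr q.1, ratr q.2).

Lemma rat_point_dense (p : E) (e : R) : 0 < e -> exists k, ball (rat_point k) e
  p.
Proof.
move=> e0.
have rat_near (x : R) : exists q : rat, ball (ratr q : R) e x.
  have [q] : exists q : rat, ratr q \in `]x - e, x + e[.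
    by apply: rat_in_itvoo; rewrite ltrD2l gtrN.
  rewrite in_itv/= => qx; exists q.
  by rewrite /ball/= ltr_distlC; move: qx; rewrite !ltrBlDr => /andP[-> ?];
    rewrite andbT// ltrBlDr.
have [q1 q1P] := choice (fun j => rat_near (p.1 ord0 j)).
have [q2 q2P] := rat_near p.2.
exists (pickle (\row_j q1 j, q2) : nat); rewrite /rat_point pickleK/=;
  split => //=.
by split=> // i j; rewrite !mxE ord1; exact: q1P.
Qed.

Lemma closureI_open (T : topologicalType) (A O : set T) :
  open O -> closure A `&` O !=set0 <-> A `&` O !=set0.
Proof.
move=> oO; split=> [[p [Ap Op]]|[p [Ap Op]]].
  by apply: Ap; exact: open_nbhs_nbhs.
by exists p; split => //; exact: subset_closure.
Qed.

(** Where the epigraph misses [O], the singleton of [p0] is used instead, so the selected sets are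
    never empty; passing to closures makes them closed without changing which open sets they meet.
    Staying in [closure O] for every [w] is what later bounds the selection. *)
Lemma epigraph_selection (f : 'rV[R]_n -> Omega -> \bar R) (O : set E) (p0 : E)
  :
  normal_integrand f -> open O -> O p0 ->
  exists2 s : Omega -> E,
    forall w, closure O (s w) /\
      (epigraph f w `&` O !=set0 -> closure (epigraph f w `&` O) (s w)) &
    (forall j, measurable_fun setT (fun w => (s w).1 ord0 j)) /\
    measurable_fun setT (fun w => (s w).2).
Proof.
move=> [cf mf] oO Op0.
pose A := [set w | epigraph f w `&` O !=set0].
pose S w := if w \in A then closure (epigraph f w `&` O) else [set p0].
have mA : measurable A by exact: mf.
have [s Ss ms] : exists2 s : Omega -> E, (forall w, S w (s w)) &
    forall phi : E -> R, continuous phi -> measurable_fun setT (phi \o s).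
  apply: (@measurable_selection _ _ _ _ rat_point).
  - exact: rat_point_dense.
  - exact: fast_cauchy_cvg_pair.
  - move=> U oU; rewrite (_ : [set _ | _] =
        (A `&` [set w | epigraph f w `&` (O `&` U) !=set0]) `|`
        (~` A `&` [set _ | U p0])).
      apply: measurableU; apply: measurableI => //.
      + by apply: mf; exact: openI.
      + exact: measurableC.
      + have [Up|Up] := pselect (U p0).
          by rewrite (_ : [set _ | _] = setT)//; apply/seteqP; split.
        by rewrite (_ : [set _ | _] = set0)//; apply/seteqP; split.
    apply/seteqP; split => w /=; rewrite /S.
      case: ifPn => [/set_mem Aw|/negP Aw].
        by move=> /(closureI_open _ oU); rewrite -setIA; left.
      by move=> [_ [-> Up]]; right; split => // Aw'; apply: Aw; rewrite inE.
    move=> [[Aw]|[Aw Up]].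
      by rewrite mem_set// setIA => /(closureI_open _ oU).
    by rewrite memNset//; exists p0.
  - move=> w; rewrite /S; case: ifPn => [/set_mem [p ?]|_]; last by exists p0.
    by exists p; exact: subset_closure.
  - move=> w; rewrite /S; case: ifPn => _; first exact: closed_closure.
    apply: accessible_closed_set1; apply: hausdorff_accessible.
    exact: norm_hausdorff.
exists s => [w|].
  have := Ss w; rewrite /S; case: ifPn => [/set_mem Aw sw|/negP Aw ->].
    by split=> //; apply: closure_subset sw; exact: subIsetr.
  by split; [exact: subset_closure|move=> Aw'; exfalso; apply: Aw; rewrite inE].
split=> [j|]; last by apply: (ms snd) => -[p1 p2]; exact: cvg_snd.
apply: (ms (fun p => p.1 ord0 j)) => p.
by apply: (@continuous_comp _ _ _ fst (fun M : 'rV[R]_n => M ord0 j));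
  [case: p => p1 p2; exact: cvg_fst|exact: coord_continuous].
Qed.

Theorem castaing (f : 'rV[R]_n -> Omega -> \bar R) : normal_integrand f ->
  exists (A : nat -> set Omega) (z : nat -> Omega -> 'rV[R]_n)
         (a : nat -> Omega -> R),
  [/\ forall k, measurable (A k),
      forall k j, measurable_fun setT (fun w => z k w ord0 j) /\
                  exists M : R, forall w, `|z k w ord0 j| <= M,
      forall k, measurable_fun setT (a k),
      forall k w, A k w -> epigraph f w (z k w, a k w) &
      forall w p (e : R), 0 < e -> epigraph f w p ->
        exists2 k, A k w & ball p e (z k w, a k w)].
Proof.
move=> nf; have [cf mf] := nf.
(* The index [k] codes a pair: the number of a rational centre and the exponent of a radius
   [2 ^- m]. *)
pose ind k : nat * nat := odflt (0, 0)%N (unpickle k).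
pose ctr k := rat_point (ind k).1; pose rad k : R := 2 ^- (ind k).2.
pose O k : set E := (ball (ctr k) (rad k))°.
have rad0 k : 0 < rad k by rewrite invr_gt0 exprn_gt0.
have rad1 k : rad k <= 1 by rewrite invf_le1 ?exprn_gt0// exprn_ege1// ler1n.
have oO k : open (O k) by exact: open_interior.
have Oc k : O k (ctr k) by exact: nbhsx_ballx.
have /choice[s Ps] : forall k, exists s : Omega -> E,
   (forall w, closure (O k) (s w) /\
      (epigraph f w `&` O k !=set0 -> closure (epigraph f w `&` O k) (s w))) /\
   ((forall j, measurable_fun setT (fun w => (s w).1 ord0 j)) /\
    measurable_fun setT (fun w => (s w).2)).
  by move=> k; have [s P1 P2] := epigraph_selection nf (oO k) (Oc k); exists s.
(* The selection lies only in the closure of the ball, hence in the ball of twice the radius. With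
   radii at most 1 this gives the [2] in the bound on [z k]. *)
have sball k w : ball (ctr k) (rad k + rad k) (s k w).
  have [q [/interior_subset Oq sq]] := ((Ps k).1 w).1 _ (nbhsx_ballx _ _ (rad0
    k)).
  by apply: ball_triangle Oq _; exact: ball_sym.
exists (fun k => [set w | epigraph f w `&` O k !=set0]), (fun k w => (s k w).1),
  (fun k w => (s k w).2); split.
- by move=> k; exact: mf.
- move=> k j; split; first exact: ((Ps k).2).1.
  exists (2 + `|(ctr k).1 ord0 j|) => w.
  have [[_ /(_ ord0 j)] + _] := sball k w.
  rewrite /ball/= => h.
  rewrite -[X in `|X|](subrK ((ctr k).1 ord0 j));
    apply: le_trans (ler_normD _ _) _.
  rewrite lerD2r distrC; apply: le_trans (ltW h) _.
  by rewrite (_ : 2 = 1 + 1)// lerD.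
- by move=> k; exact: ((Ps k).2).2.
- move=> k w Aw; rewrite -surjective_pairing.
  apply: cf; apply: closure_subset ((((Ps k).1 w).2 Aw)); exact: subIsetl.
- move=> w p e e0 fp.
  (* One radius from [p] to the centre and two from the centre to the selection. *)
  have e30 : 0 < e / 3 by rewrite divr_gt0.
  have [m _ /(_ m (leqnn m))] := near_infty_natSinv_expn_lt (PosNum e30).
  rewrite /= div1r => me.
  have [|i ip] := @rat_point_dense p (2 ^- m / 2);
    first by rewrite divr_gt0// invr_gt0 exprn_gt0.
  pose k : nat := pickle (i, m).
  have ck : ctr k = rat_point i by rewrite /ctr /ind pickleK.
  have rk : rad k = 2 ^- m by rewrite /rad /ind pickleK.
  have cp : ball (ctr k) (rad k) p.
    by rewrite ck rk; apply: le_ball ip;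
      rewrite ler_pdivrMr// ler_peMr// ?ler1n// invr_ge0 exprn_ge0.
  have Op : O k p.
    apply/nbhs_ballP; exists (rad k / 2) => /=; first by rewrite divr_gt0.
    move=> q pq; rewrite ck (splitr (rad k)); apply: ball_triangle pq.
    by rewrite rk.
  exists k; first by exists p.
  rewrite -surjective_pairing;
    apply: (@le_ball _ _ _ (rad k + (rad k + rad k))).
    rewrite rk; move: me; rewrite ltr_pdivlMr// => /ltW; apply: le_trans.
    by rewrite mulr_natr -mulr2n -mulrS.
  by apply: ball_triangle (sball k w); exact: ball_sym.
Qed.
End Castaing.

Local Open Scope ereal_scope.

(** * Integrals and pairings *)

Section ExtendedReals.
Context (R : realType).

(** As [r] is real, no difference of infinities arises, so terms can be moved even where [Ef] or a
    conjugate is infinite. *)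
Lemma lee_subr_swap (r : R) (s t : \bar R) : s <= r%:E - t -> t <= r%:E - s.
Proof.
case: s => [s| |]; case: t => [t| |]//; rewrite ?addeNy ?addey ?leey ?leNye//.
by rewrite -!EFinB !lee_fin lerBrDr addrC -lerBrDr.
Qed.

Lemma lee_subl_swap (r : R) (s t : \bar R) : r%:E - s <= t -> r%:E - t <= s.
Proof.
case: s => [s| |]; case: t => [t| |]//; rewrite ?addeNy ?addey ?leey ?leNye//.
by rewrite -!EFinB !lee_fin lerBlDr addrC -lerBlDr.
Qed.

Lemma oppe_subl (r : R) (s : \bar R) : - (r%:E - s) = s - r%:E.
Proof. by case: s => [s| |]//; rewrite -!EFinB -EFinN opprB. Qed.

Lemma sube_subr (r q : R) (s : \bar R) : r%:E - (s - q%:E) = q%:E + r%:E - s.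
Proof. by case: s => [s| |]//; rewrite -!(EFinB, EFinD); congr EFin; ring. Qed.

End ExtendedReals.

Section Integration.
Context (d : measure_display) (Omega : measurableType d) (R : realType).
Context (P : probability Omega R).
Implicit Types g h : Omega -> \bar R.

Lemma le_funepos h w : h w <= h^\+ w.
Proof. by rewrite unlock le_max lexx. Qed.

Lemma ae_le_integrable g h : measurable_fun setT h -> P.-integrable setT g ->
  {ae P, forall w, `|h w| <= `|g w|} -> P.-integrable setT h.
Proof.
move=> mh /integrableP[mg ig] hg; apply/integrableP; split => //.
apply: le_lt_trans ig; apply: ae_ge0_le_integral => //.
- exact: measurableT_comp.
- exact: measurableT_comp.
- by apply: filterS hg.
Qed.

(** The minimum of [g] and [h] equals [g] almost surely and is below [h] everywhere, which reduces
    the claim to pointwise monotonicity. *)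
Lemma ae_le_integral g h : P.-integrable setT g -> P.-integrable setT h ->
  {ae P, forall w, g w <= h w} -> \int[P]_w g w <= \int[P]_w h w.
Proof.
move=> ig ih gh; pose k w := mine (g w) (h w).
have mg := measurable_int _ ig; have mh := measurable_int _ ih.
have mk : measurable_fun setT k by exact: measurable_mine.
have gk : {ae P, forall w, g w = k w}.
  by apply: filterS gh => w gh; rewrite /k min_l.
rewrite (@ae_eq_integral _ _ _ P setT k g)//; last first.
  by apply: filterS gk => w ? _.
apply: le_integral => // [|w _]; last by rewrite /k ge_min lexx orbT.
by apply: ae_le_integrable ig _ => //; apply: filterS gk => w <-.
Qed.

Lemma Eext_integrable h : P.-integrable setT h -> Eext P h = \int[P]_w h w.
Proof.
by move=> ih; rewrite /Eext; case: asboolP => // -[]; exact: integrable_funepos.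
Qed.

Lemma Eext_fin_integrable h : measurable_fun setT h ->
  -oo < Eext P h -> Eext P h < +oo -> P.-integrable setT h.
Proof.
move=> mh; rewrite /Eext; case: asboolP => // ihp hN hy.
apply/integrableP; split => //.
have ipos : \int[P]_w h^\+ w \is a fin_num.
  by apply: integrable_fin_num.
have : \int[P]_w h^\- w < +oo.
  rewrite ltey; apply/eqP => hm; move: hN.
  by rewrite integralE hm -(fineK ipos).
move=> hm; rewrite (_ : (fun w => `|h w|) = h^\+ \+ h^\-);
  last by rewrite -fune_abse.
rewrite ge0_integralD//; last 2 first.
- exact: measurable_funepos.
- exact: measurable_funeneg.
by rewrite lte_add_pinfty// ltey_eq ipos.
Qed.

(** The positive part of [h] is dominated by that of [g], so [Eext] is a true integral, possibly
    [-oo]. Positive and negative parts are compared separately for that reason. *)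
Lemma Eext_le g h : measurable_fun setT h -> P.-integrable setT g ->
  {ae P, forall w, h w <= g w} -> Eext P h <= \int[P]_w g w.
Proof.
move=> mh ig hg.
have mg := measurable_int _ ig.
have hgp : {ae P, forall w, h^\+ w <= g^\+ w}.
  by apply: filterS hg => w hg; rewrite !unlock ge_max !le_max hg lexx orbT.
have ihp : P.-integrable setT h^\+.
  apply: ae_le_integrable (integrable_funepos _ ig) _ => //.
    exact: measurable_funepos.
  by apply: filterS hgp => w hgp; rewrite !gee0_abs.
rewrite /Eext; case: asboolP => // _.
rewrite integralE [leRHS]integralE leeB//; apply: ae_ge0_le_integral => //.
- exact: measurable_funepos.
- exact: measurable_funepos.
- by apply: filterS hgp.
- exact: measurable_funeneg.
- exact: measurable_funeneg.
- apply: filterS hg => w hg _.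
  by rewrite !unlock ge_max !le_max leeN2 hg lexx orbT.
Qed.

(** Unless [Eext P h] is [+oo], the positive part of [h] is integrable, and the negative part is at
    most [|g|]; hence [h] is integrable. *)
Lemma ge_Eext g h : measurable_fun setT h -> P.-integrable setT g ->
  {ae P, forall w, g w <= h w} -> \int[P]_w g w <= Eext P h.
Proof.
move=> mh ig gh; have [->|hy] := eqVneq (Eext P h) +oo; first exact: leey.
have ihp : P.-integrable setT h^\+ by move: hy; rewrite /Eext;
  case: asboolP => //; rewrite eqxx.
have ih : P.-integrable setT h.
  have isum := integrableD measurableT ihp (integrable_abse ig).
  apply: ae_le_integrable isum _ => //.
  apply: filterS gh => w gh /=; rewrite [leRHS]gee0_abs ?adde_ge0//.
  rewrite -/((abse \o h) w) fune_abse leeD2l//.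
  rewrite !unlock /= ge_max abse_ge0 andbT.
  by apply: le_trans (_ : - g w <= _); rewrite ?leeN2// -abseN lee_abs.
by rewrite Eext_integrable//; exact: ae_le_integral.
Qed.

End Integration.

(** * The spaces L^p and the bilinear pairing *)

Section Lvec.
Context (d : measure_display) (Omega : measurableType d) (R : realType).
Context (P : probability Omega R) (n : nat).
Implicit Types x z v : Omega -> 'rV[R]_n.

Lemma LinftyP (g : Omega -> R) : g \in Lfun P +oo <->
  measurable_fun setT g /\ exists M, {ae P, forall w, (`|g w| <= M)%R}.
Proof.
split=> [|[mg [M gM]]].
  (* The norm of exponent [+oo] is the essential supremum when the space has positive measure; total
     mass 1 selects this branch. *)
  rewrite inE => /andP[/[!inE]/= mg]; rewrite /finite_norm unlock ifT => [gy|];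
    last first.
    by have := @lte01 R; rewrite -(probability_setT P).
  split => //; apply: (@ess_supr_bounded _ _ _ P (fun w => `|g w|%R)).
  exact: gy.
rewrite inE; apply/andP; split; rewrite inE//= /finite_norm unlock.
rewrite ifT; last by have := @lte01 R; rewrite -(probability_setT P).
apply: (@le_lt_trans _ _ M%:E); last exact: ltry.
by apply/ess_supP; apply: filterS gM => w; rewrite /= lee_fin.
Qed.

Lemma Lvec_measurable p x j : Lvec P p x -> measurable_fun setT (fun w => x w
  ord0 j).
Proof. by move=> /(_ j); rewrite inE => /andP[/[!inE]]. Qed.

Lemma measurable_dotp x v :
  (forall j, measurable_fun setT (fun w => x w ord0 j)) ->
  (forall j, measurable_fun setT (fun w => v w ord0 j)) ->
  measurable_fun setT (fun w => dotp (x w) (v w)).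
Proof.
by move=> mx mv; apply: measurable_sum => j; apply: measurable_funM.
Qed.

Lemma Linfty_mul_integrable (g h : Omega -> R) : g \in Lfun P +oo ->
  P.-integrable setT (EFin \o h) -> P.-integrable setT (fun w => (g w * h
    w)%:E).
Proof.
move=> /LinftyP[mg [M gM]] ih.
have mh : measurable_fun setT h by apply/measurable_EFinP;
  exact: measurable_int ih.
apply: (ae_le_integrable _ (integrableZl measurableT M ih)).
  by apply/measurable_EFinP; exact: measurable_funM.
apply: filterS gM => w gM /=; rewrite lee_fin !normrM ler_wpM2r//.
exact: le_trans gM (ler_norm _).
Qed.

Lemma dotp_integrable x v : Lvec P +oo x -> Lvec P 1 v ->
  P.-integrable setT (fun w => (dotp (x w) (v w))%:E).
Proof.
move=> xoo v1; rewrite (_ : (fun _ => _) = fun w =>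
   \sum_(j < n) (x w ord0 j * v w ord0 j)%:E); last first.
  by apply/funext => w; rewrite sumEFin.
apply: integrable_sum => // j _; apply: Linfty_mul_integrable => //.
by apply/Lfun1_integrable; exact: v1.
Qed.

Lemma pairingE x v : pairing P x v = \int[P]_w (dotp (x w) (v w))%:E.
Proof. by rewrite /pairing unlock. Qed.

Lemma pairing_fin_num x v : Lvec P +oo x -> Lvec P 1 v ->
  pairing P x v \is a fin_num.
Proof. by move=> *; rewrite pairingE integrable_fin_num//;
  exact: dotp_integrable. Qed.

Lemma dotpDl (u u' v : 'rV[R]_n) : dotp (u + u')%R v = (dotp u v + dotp u' v)%R.
Proof. by rewrite /dotp -big_split; apply: eq_bigr => j _;
  rewrite mxE mulrDl. Qed.

Lemma dotpDr (u v v' : 'rV[R]_n) : dotp u (v + v')%R = (dotp u v + dotp u v')%R.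
Proof. by rewrite /dotp -big_split; apply: eq_bigr => j _;
  rewrite mxE mulrDr. Qed.

Lemma dotpZl k (u v : 'rV[R]_n) : dotp (k *: u)%R v = (k * dotp u v)%R.
Proof. by rewrite /dotp mulr_sumr; apply: eq_bigr => j _;
  rewrite mxE mulrA. Qed.

Lemma dotpNl (u v : 'rV[R]_n) : dotp (- u)%R v = (- dotp u v)%R.
Proof. by rewrite -scaleN1r dotpZl mulN1r. Qed.

Lemma dotpBl (u u' v : 'rV[R]_n) : dotp (u - u')%R v = (dotp u v - dotp u' v)%R.
Proof. by rewrite dotpDl dotpNl. Qed.

Lemma pairingDl x z v : Lvec P +oo x -> Lvec P +oo z -> Lvec P 1 v ->
  pairing P (fun w => x w + z w)%R v = pairing P x v + pairing P z v.
Proof.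
move=> xoo zoo v1; rewrite !pairingE -integralD//; [|exact: dotp_integrable..].
by apply: eq_integral => w _; rewrite dotpDl EFinD.
Qed.

Lemma pairingBl x z v : Lvec P +oo x -> Lvec P +oo z -> Lvec P 1 v ->
  pairing P (fun w => x w - z w)%R v = pairing P x v - pairing P z v.
Proof.
move=> xoo zoo v1; rewrite !pairingE -integralB//; [|exact: dotp_integrable..].
by apply: eq_integral => w _; rewrite dotpBl EFinB.
Qed.

Lemma pairingDr x u v : Lvec P +oo x -> Lvec P 1 u -> Lvec P 1 v ->
  pairing P x (fun w => u w + v w)%R = pairing P x u + pairing P x v.
Proof.
move=> xoo u1 v1; rewrite !pairingE -integralD//; [|exact: dotp_integrable..].
by apply: eq_integral => w _; rewrite dotpDr EFinD.
Qed.

Lemma pairingZl k x v : Lvec P +oo x -> Lvec P 1 v ->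
  pairing P (fun w => k *: x w)%R v = k%:E * pairing P x v.
Proof.
move=> xoo v1; rewrite !pairingE -integralZl//; last exact: dotp_integrable.
by apply: eq_integral => w _; rewrite dotpZl EFinM.
Qed.

Lemma pairing0l v : pairing P (cst 0%R) v = 0.
Proof.
rewrite pairingE integral0_eq// => w _; rewrite /dotp big1// => j _.
by rewrite mxE mul0r.
Qed.

Lemma LvecD p x z : 1 <= p -> Lvec P p x -> Lvec P p z ->
  Lvec P p (fun w => x w + z w)%R.
Proof.
move=> p1 xp zp j; rewrite (_ : (fun _ => _) =
  ((fun w => x w ord0 j) \+ (fun w => z w ord0 j))%R); last first.
  by apply/funext => w; rewrite mxE.
by have [_ /(_ _ _ (xp j) (zp j))] := @Lfun_addr_closed _ _ _ P _ p1.
Qed.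

Lemma Lvec_inftyZ k x : Lvec P +oo x -> Lvec P +oo (fun w => k *: x w)%R.
Proof.
move=> xoo j; have /LinftyP[mx [M xM]] := xoo j; apply/LinftyP; split.
  rewrite (_ : (fun _ => _) = fun w => (k * x w ord0 j)%R); last first.
    by apply/funext => w; rewrite mxE.
  exact: measurable_funM.
exists (`|k| * M)%R; apply: filterS xM => w xM.
by rewrite mxE normrM ler_wpM2l.
Qed.

Lemma Lvec_inftyN x : Lvec P +oo x -> Lvec P +oo (fun w => - x w)%R.
Proof.
move=> /(Lvec_inftyZ (-1)); congr (Lvec P +oo _).
by apply/funext => w; rewrite scaleN1r.
Qed.

Lemma Lvec_inftyB x z : Lvec P +oo x -> Lvec P +oo z ->
  Lvec P +oo (fun w => x w - z w)%R.
Proof. by move=> xoo /Lvec_inftyN; apply: LvecD => //; exact: leey. Qed.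

Lemma Lvec_infty0 : Lvec P +oo (cst 0%R : Omega -> 'rV[R]_n).
Proof.
by move=> j; apply/LinftyP; split; [|exists 0%R; apply: nearW => w];
  rewrite /= ?mxE ?normr0.
Qed.

End Lvec.

(** * Interchange of integration and conjugation *)

Section Interchange.
Context (d : measure_display) (Omega : measurableType d) (R : realType).
Context (P : probability Omega R) (n : nat).
Context (f : 'rV[R]_n -> Omega -> \bar R).
Implicit Types x z v : Omega -> 'rV[R]_n.

(** The point [(x w, r)] is in the epigraph exactly when selections valid at [w] come arbitrarily
    close to it: density gives one direction, closedness the other. This is a countable condition on
    [w]. *)
Lemma measurable_integrand x : normal_integrand f ->
  (forall j, measurable_fun setT (fun w => x w ord0 j)) ->
  measurable_fun setT (fun w => f (x w) w).
Proof.
move=> nf mx; have [cf _] := nf.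
have [A [z [a [mA mz ma Aepi dense]]]] := castaing nf.
suff le_meas r : measurable [set w | f (x w) w <= r%:E].
  move=> mT; apply: (measurability _ (ErealGenOInfty.measurableE R)) => //.
  move=> _ [_ [r ->] <-]; rewrite setTI.
  rewrite (_ : _ @^-1` _ = ~` [set w | f (x w) w <= r%:E]);
    first exact: measurableC.
  apply/seteqP; split => w /=; rewrite in_itv/= andbT;
    first by rewrite ltNge => /negP.
  by move=> /negP; rewrite -ltNge.
pose C k m := [set w | ball (x w, r) (m.+1%:R^-1) (z k w, a k w)].
rewrite (_ : [set _ | _] = \bigcap_m \bigcup_k (A k `&` C k m)).
  apply: bigcapT_measurable => m; apply: bigcupT_measurable => k.
  apply: measurableI => //.
  rewrite (_ : C k m = [set w | (`|r - a k w| < m.+1%:R^-1)%R] `&`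
     \bigcap_(j in [set: 'I_n]) [set w | (`|x w ord0 j - z k w ord0 j| <
       m.+1%:R^-1)%R]).
    apply: measurableI; [|apply: fin_bigcap_measurable => [|j _]].
    - have mh : measurable_fun setT (fun w => `|r - a k w|%R < m.+1%:R^-1)%R.
        apply: measurable_fun_ltr => //; apply: measurableT_comp => //.
        exact: measurable_funB.
      by rewrite -[X in measurable X]setTI; exact: mh measurableT [set true] _.
    - exact: finite_finset.
    - have mh : measurable_fun setT
          (fun w => `|x w ord0 j - z k w ord0 j|%R < m.+1%:R^-1)%R.
        apply: measurable_fun_ltr => //; apply: measurableT_comp => //.
        by apply: measurable_funB => //; have [] := mz k j.
      by rewrite -[X in measurable X]setTI; exact: mh measurableT [set true] _.
  apply/seteqP; split => w /=; rewrite /C/=.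
    by move=> [[/= _ h1] h2]; split => // j _; exact: h1.
  move=> [h1 h2]; split => //=; split => // i j; rewrite ord1; exact: h2.
apply/seteqP; split => w /=.
  move=> fr m _; have [|k Ak b] := dense w (x w, r) m.+1%:R^-1%R _ fr;
    first by rewrite invr_gt0.
  by exists k.
move=> h; have : epigraph f w (x w, r); last by [].
apply: cf => U /nbhs_ballP[e /= e0 eU].
have [m _ /(_ m (leqnn m))/= me] := near_infty_natSinv_lt (PosNum e0).
have [k _ [Ak b]] := h m I.
exists (z k w, a k w); split; first exact: Aepi.
by apply: eU; exact: le_ball (ltW me) _ b.
Qed.

(** The conjugate is the supremum of [dotp xi v - r] over epigraph points [(xi, r)]; this functional
    is Lipschitz, so nearby points of [D] suffice. *)
Lemma conjugate_le_dense (h : 'rV[R]_n -> \bar R) (D : set ('rV[R]_n * R))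
    (v : 'rV[R]_n) (b : \bar R) :
  (forall p e, (0 < e)%R -> h p.1 <= p.2%:E -> exists2 q, D q & ball p e q) ->
  (forall q, D q -> (dotp q.1 v - q.2)%:E <= b) ->
  conjugate h v <= b.
Proof.
move=> dense Db; apply: ge_ereal_sup => _ [xi _ <-].
suff epib r : h xi <= r%:E -> (dotp xi v - r)%:E <= b.
  case hxi : (h xi) => [r| |]; last 2 first.
  - by rewrite addeNy leNye.
  (* Where [h xi] is [-oo] the whole vertical line lies in the epigraph; height [dotp xi v - y]
     produces the value [y], with [y] arbitrarily large. *)
  - rewrite /= leye_eq; apply/eqP/eqyP => y y0.
    apply: le_trans (epib (dotp xi v - y)%R _);
      first by rewrite lee_fin opprB addrC subrK.
    by rewrite hxi leNye.
  - by rewrite -EFinB epib// hxi.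
move=> hr; apply/lee_addgt0Pr => e e0.
(* A Lipschitz constant of [dotp xi v - r] for entrywise distance: the sum accounts for [xi] and the
   [1] for [r]. *)
pose C := (\sum_(j < n) `|v ord0 j| + 1)%R.
have C0 : (0 < C)%R by rewrite ltr_wpDl// sumr_ge0.
have eC : (0 < e / C)%R by rewrite divr_gt0.
have [q Dq [/= [_ bq1] bq2]] := dense (xi, r) _ eC hr.
apply: (@le_trans _ _ ((dotp q.1 v - q.2)%:E + e%:E));
  last by rewrite leeD2r// Db.
rewrite -EFinD lee_fin -lerBlDl.
have -> : (dotp xi v - r - (dotp q.1 v - q.2) = dotp (xi - q.1) v + (q.2 -
  r))%R.
  by rewrite dotpBl; ring.
have -> : (e = \sum_(j < n) (e / C * `|v ord0 j|) + e / C)%R.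
  by rewrite -mulr_sumr -[X in (_ + X)%R]mulr1 -mulrDr divfK// gt_eqF.
apply: lerD.
  apply: ler_sum => j _; rewrite !mxE; apply: le_trans (ler_norm _) _.
  by rewrite normrM ler_wpM2r// ltW//; exact: bq1.
by apply: le_trans (ler_norm _) _; rewrite distrC ltW.
Qed.

Lemma measurable_mem (A : set Omega) :
  measurable A -> measurable_fun setT (fun w => w \in A).
Proof.
move=> mA; apply: (@measurable_fun_bool _ _ _ _ true).
rewrite setTI (_ : _ @^-1` _ = A)//.
by apply/seteqP; split => w /=; [exact: set_mem|exact: mem_set].
Qed.

Lemma fenchel_young (h : 'rV[R]_n -> \bar R) (xi v : 'rV[R]_n) :
  (dotp xi v)%:E - h xi <= conjugate h v.
Proof. by apply: ereal_sup_ubound; exists xi. Qed.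

(** By density the conjugate is the supremum of the countable family [u k]; the value [-oo] off
    [A k] discards selections that are not valid there. *)
Lemma measurable_conj_integrand v : normal_integrand f ->
  (forall j, measurable_fun setT (fun w => v w ord0 j)) ->
  measurable_fun setT (fun w => conj_integrand f (v w) w).
Proof.
move=> nf mv; have [A [z [a [mA mz ma Aepi dense]]]] := castaing nf.
pose u k w := if w \in A k then (dotp (z k w) (v w) - a k w)%:E else -oo.
have mu k : measurable_fun setT (u k).
  apply: measurable_fun_ifT => //.
  - exact: measurable_mem.
  - apply/measurable_EFinP; apply: measurable_funB => //.
    by apply: measurable_dotp => // j; have [] := mz k j.
rewrite (_ : (fun _ => _) = fun w => esups (u ^~ w) 0%N).
  exact: measurable_fun_esups.
apply/funext => w; apply/eqP; rewrite eq_le; apply/andP; split.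
  apply: (conjugate_le_dense
    (D := [set q | exists2 k, A k w & q = (z k w, a k w)])).
    move=> p e e0 /(dense w _ _ e0)[k Ak b].
    by exists (z k w, a k w) => //; exists k.
  move=> _ [k Ak ->] /=; apply: ereal_sup_ubound; exists k => //=.
  by rewrite /u mem_set.
apply: ge_ereal_sup => _ [k _ <-]; rewrite /u; case: ifPn => [/set_mem Ak|_];
  last exact: leNye.
apply: le_trans (fenchel_young _ (z k w) _).
by rewrite EFinB leeB// ; exact: Aepi.
Qed.

Lemma Ef_integrable z : normal_integrand f -> proper_on_Linfty P f ->
  Lvec P +oo z -> Ef P f z < +oo -> P.-integrable setT (fun w => f (z w) w).
Proof.
move=> nf [pf _] zoo fz; apply: Eext_fin_integrable => //; last exact: pf.
by apply: measurable_integrand => // j; exact: Lvec_measurable zoo.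
Qed.

Lemma conj_Linfty_le v : normal_integrand f -> proper_on_Linfty P f -> Lvec P 1
  v ->
  conj_Linfty P (Ef P f) v <= Ef P (conj_integrand f) v.
Proof.
move=> nf pf v1; apply: ge_ereal_sup => _ [z zoo <-].
have [->|fz] := eqVneq (Ef P f z) +oo; first by rewrite addeNy leNye.
have iz := Ef_integrable nf pf zoo (ltac:(by rewrite ltey)).
have izv := dotp_integrable zoo v1.
rewrite /Ef Eext_integrable// pairingE -integralB//.
apply: ge_Eext.
- by apply: measurable_conj_integrand => // j; exact: Lvec_measurable v1.
- exact: integrableB.
- by apply: nearW => w; exact: fenchel_young.
Qed.

Lemma Ef_conj_integrand v : normal_integrand f -> proper_on_Linfty P f -> Lvec
  P 1 v ->
  Ef P (conj_integrand f) v = conj_Linfty P (Ef P f) v.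
Proof.
move=> nf pf v1; apply/eqP; rewrite eq_le conj_Linfty_le// andbT.
set M := conj_Linfty _ _ _; have [z0 z0oo fz0] := pf.2.
have mv j := Lvec_measurable j v1.
have [A [z [a [mA mz ma Aepi dense]]]] := castaing nf.
pose val (y : Omega -> 'rV[R]_n) w : \bar R := (dotp (y w) (v w))%:E - f (y w)
  w.
pose better y k w := (w \in A k) && (val y w < (dotp (z k w) (v w) - a k w)%:E).
(* [zeta m] improves greedily on [z0] along the dense selections; properness
   keeps every [f (zeta m)] integrable, so monotone convergence applies. *)
pose zeta := fix zeta m w :=
  if m is k.+1 then if better (zeta k) k w then z k w else zeta k w else z0 w.
pose G m := val (zeta m).
have mval (y : Omega -> 'rV[R]_n) : (forall j, measurable_fun setT (fun w => y
  w ord0 j)) -> measurable_fun setT (val y).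
  move=> my; apply: emeasurable_funB; last exact: measurable_integrand.
  by apply/measurable_EFinP; exact: measurable_dotp.
have zoo m : Lvec P +oo (zeta m).
  elim: m => [//|m IH] j; have /LinftyP[mzm [B zB]] := IH j.
  have [mzj [B' zB']] := mz m j.
  have -> : (fun w => zeta m.+1 w ord0 j) =
     fun w => if better (zeta m) m w then z m w ord0 j else zeta m w ord0 j.
    by apply/funext => w /=; case: ifP.
  apply/LinftyP; split.
    apply: measurable_fun_ifT => //.
    apply: measurable_and.
      exact: measurable_mem.
    apply: measurable_fun_lte.
      by apply: mval => i; exact: Lvec_measurable IH.
    apply/measurable_EFinP; apply: measurable_funB => //.
    by apply: measurable_dotp => // i; have [] := mz m i.
  exists (Num.max B B'); apply: filterS zB => w zB.
  by case: ifP => _; rewrite le_max ?zB ?zB' ?orbT.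
have GS m w : G m w <= G m.+1 w.
  rewrite /G /val /=; case: ifPn => // /andP[/set_mem Aw /ltW lt].
  by apply: le_trans lt _; rewrite EFinB leeB//; exact: Aepi.
(* Selection [m] is compared at stage [m], so its value is only accounted for from [m.+1] on. *)
have GA m w : A m w -> (dotp (z m w) (v w) - a m w)%:E <= G m.+1 w.
  move=> Aw; rewrite /G /val /=; case: ifPn.
    by move=> _; rewrite EFinB leeB//; exact: Aepi.
  by rewrite /better mem_set//= -leNgt.
have GH w : {homo G^~ w : i j / (i <= j)%N >-> i <= j}.
  by apply: homo_leq => [//|y x t|m]; [exact: le_trans|exact: GS].
have iz0 := Ef_integrable nf pf z0oo fz0.
have iG0 : P.-integrable setT (G 0%N) by apply: integrableB => //;
  exact: dotp_integrable.
(* Since [G 0] is below [G m], the function [f (zeta m)] is at most the integrable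
   [dotp (zeta m) v - G 0]; this puts [zeta m] in the domain of [Ef]. *)
have iz m : P.-integrable setT (fun w => f (zeta m w) w).
  apply: Ef_integrable => //.
  have ig := integrableB measurableT (dotp_integrable (zoo m) v1) iG0.
  apply: le_lt_trans (integrable_lty measurableT ig).
  apply: Eext_le => //.
    by apply: measurable_integrand => // j; exact: Lvec_measurable (zoo m).
  apply: nearW => w /=; have := GH w _ _ (leq0n m).
  exact: lee_subr_swap.
have iG m : P.-integrable setT (G m) by apply: integrableB => //;
  exact: dotp_integrable.
have GM m : \int[P]_w G m w <= M.
  rewrite integralB//; last exact: dotp_integrable.
  apply: ereal_sup_ubound; exists (zeta m) => //.
  by rewrite /Ef Eext_integrable// pairingE.
have [->|My] := eqVneq M +oo; first exact: leey.
pose g0 w := fine (G 0%N w).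
have G0g0 : {ae P, forall w, G 0%N w = (g0 w)%:E}.
  by apply: filterS (integrable_ae measurableT iG0) => w /(_ I) ?;
    rewrite fineK.
have mg0 : measurable_fun setT (EFin \o g0).
  by apply/measurable_EFinP; apply: measurableT_comp => //;
    exact: measurable_int iG0.
have ig0 : P.-integrable setT (EFin \o g0).
  by apply: ae_le_integrable iG0 _ => //; apply: filterS G0g0 => w /= ->.
(* Subtracting the finite version [g0] of [G 0] gives an increasing sequence that is nonnegative
   almost surely. The maximum with [0] repairs the null set where [G 0] is infinite, so monotone
   convergence applies. *)
pose u m w := maxe (G m w - (g0 w)%:E) 0.
have mu m : measurable_fun setT (u m).
  apply: measurable_maxe => //; apply: emeasurable_funB => //.
  exact: measurable_int (iG m).
have u0 m w : 0 <= u m w by rewrite le_max lexx orbT.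
have uH w : {homo u^~ w : i j / (i <= j)%N >-> i <= j}.
  by move=> i j ij; rewrite /u ge_max !le_max lexx orbT andbT leeB// GH.
have intu m : \int[P]_w u m w <= M - \int[P]_w (g0 w)%:E.
  rewrite (@ae_eq_integral _ _ _ P setT (G m \- (EFin \o g0))) //.
  - by rewrite integralB// leeB// GM.
  - by apply: emeasurable_funB => //; exact: measurable_int (iG m).
  - apply: filterS G0g0 => w G0 _ /=; rewrite /u max_l// sube_ge0//;
    last by rewrite -G0 GH.
pose U w := limn (u^~ w).
have uU m w : u m w <= U w.
  rewrite /U (cvg_lim _ (ereal_nondecreasing_cvgn (uH w)))//.
  by apply: ereal_sup_ubound; exists m.
have intU : \int[P]_w U w <= M - \int[P]_w (g0 w)%:E.
  rewrite monotone_convergence//; apply: lime_le.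
    apply: ereal_nondecreasing_is_cvgn => i j ij;
      apply: ge0_le_integral => // w _; exact: uH.
  by apply: nearW => m; exact: intu.
have mU : measurable_fun setT U.
  apply: (emeasurable_fun_cvg u) => // w _.
  by rewrite /U (cvg_lim _ (ereal_nondecreasing_cvgn (uH w)))//;
    exact: ereal_nondecreasing_cvgn.
have fg0 : \int[P]_w (g0 w)%:E \is a fin_num by exact: integrable_fin_num.
have MNy : M != -oo.
  apply/eqP => MN; have := GM 0%N; rewrite MN leeNy_eq => /eqP;
    move: (integrable_fin_num measurableT iG0).
  by move=> + e; rewrite e.
have fM : M \is a fin_num by case: (M) My MNy.
have iU : P.-integrable setT U.
  apply/integrableP; split => //.
  apply: (@le_lt_trans _ _ (M - \int[P]_w (g0 w)%:E)).
    apply: le_trans intU; rewrite le_eqVlt; apply/orP; left; apply/eqP.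
    by apply: eq_integral => w _;
      rewrite gee0_abs// (le_trans (u0 0%N _) (uU _ _)).
  by rewrite -(fineK fM) -(fineK fg0) -EFinB ltry.
apply: (@le_trans _ _ (\int[P]_w (U \+ (EFin \o g0)) w)); last first.
  by rewrite integralD//= -leeBrDr.
apply: Eext_le; first exact: measurable_conj_integrand.
  exact: integrableD.
apply: nearW => w.
have GU m : G m w <= U w + (g0 w)%:E.
  by rewrite -leeBlDr//; apply: le_trans (uU m w); rewrite le_max lexx.
apply: (conjugate_le_dense
    (D := [set q | exists2 k, A k w & q = (z k w, a k w)])).
  move=> p e e0 /(dense w _ _ e0)[k Ak b].
  by exists (z k w, a k w) => //; exists k.
by move=> _ [k Ak ->] /=; exact: le_trans (GA _ _ Ak) (GU _).
Qed.
End Interchange.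

(** * Conditional expectations *)

Section ConditionalExpectation.
Context (d : measure_display) (Omega : measurableType d) (R : realType).
Context (P : probability Omega R).
Context (G : set (set Omega)).
Implicit Types X Y : Omega -> R.

(** A sigma-algebra generates itself, so the closure properties of [measurable_fun] become available
    for [G]-measurability. *)
Lemma sub_measurableP X : sigma_algebra setT G ->
  sub_measurable G X <-> @measurable_fun _ _ (g_sigma_algebraType G) _ setT X.
Proof.
move=> sG; have GE := measurable_g_measurableTypeE sG.
split=> [GX _ B mB|mX B mB].
  by rewrite setTI; rewrite [X in X _]GE; exact: GX.
by have := mX measurableT B mB; rewrite setTI GE.
Qed.

Lemma sub_measurable_measurable X : G `<=` measurable ->
  sub_measurable G X -> measurable_fun setT X.
Proof. by move=> Gm GX _ B mB; rewrite setTI; apply/Gm/GX. Qed.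

Lemma integral_mul_indic (A : set Omega) (W : Omega -> \bar R) : measurable A ->
  \int[P]_w ((\1_A w)%:E * W w) = \int[P]_(w in A) W w.
Proof.
move=> mA; rewrite [RHS]integral_mkcond; apply: eq_integral => w _.
by rewrite patchE indicE; case: (w \in A); rewrite ?mul1e ?mul0e.
Qed.

(* Replacing [y] by [y - M 1_(y >= 0) + M / 2] halves the bound on [y] without
   changing the integral. *)
Lemma bounded_integral_mul_le (W : Omega -> R) k : sigma_algebra setT G ->
  G `<=` measurable -> P.-integrable setT (EFin \o W) ->
  (forall A, G A -> \int[P]_(w in A) (W w)%:E = 0) ->
  forall (y : Omega -> R) M, sub_measurable G y -> (forall w, `|y w| <= M)%R ->
  `|\int[P]_w (y w * W w)%:E| <= (M / 2 ^+ k)%:E * \int[P]_w `|(W w)%:E|.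
Proof.
move=> sG Gm iW W0.
have mW : measurable_fun setT W by apply/measurable_EFinP;
  exact: measurable_int iW.
have bint (y : Omega -> R) M : sub_measurable G y -> (forall w, `|y w| <= M)%R
  ->
    P.-integrable setT (fun w => (y w * W w)%:E).
  move=> Gy yM; apply: Linfty_mul_integrable => //; apply/LinftyP.
  by split; [exact: sub_measurable_measurable Gy|exists M; exact: nearW].
elim: k => [|k IH] y M Gy yM.
  have iy := bint _ _ Gy yM.
  apply: le_trans (le_abse_integral _ _ (measurable_int _ iy)) _ => //.
  rewrite expr0 divr1 -integralZl//; last exact: integrable_abse iW.
  apply: ge0_le_integral => //.
  - by apply: measurableT_comp => //; exact: measurable_int iy.
  - by apply: emeasurable_funM => //; apply: measurableT_comp => //;
    exact: measurable_int iW.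
  - by move=> w _ /=; rewrite lee_fin normrM ler_wpM2r.
pose A := [set w | 0 <= y w]%R.
have GA : G A.
  have -> : A = y @^-1` `[0%R, +oo[%classic by apply/seteqP; split => w /=;
    rewrite in_itv/= andbT.
  exact: Gy.
have mA := Gm _ GA.
pose y' w := (y w - M * \1_A w + M / 2)%R.
have Gy' : sub_measurable G y'.
  apply/sub_measurableP => //; apply: measurable_funD => //.
  apply: measurable_funB; first exact/sub_measurableP.
  apply: measurable_funM => //; apply: measurable_indic.
  by rewrite measurable_g_measurableTypeE.
have y'M w : (`|y' w| <= M / 2)%R.
  have := yM w; rewrite /y' indicE !ler_norml => /andP[yl yu].
  have [Aw|Aw] := boolP (w \in A).
    by move: (set_mem Aw); rewrite /A/= => y0; rewrite mulr1; apply/andP;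
      split; lra.
  have y0 : (y w < 0)%R by rewrite ltNge; apply: contra Aw => ?; exact: mem_set.
  by rewrite mulr0 subr0; apply/andP; split; lra.
have -> : \int[P]_w (y w * W w)%:E = \int[P]_w (y' w * W w)%:E.
  have iA : P.-integrable setT (fun w => (\1_A w)%:E * (W w)%:E).
    apply: (bint \1_A 1%R).
      apply/sub_measurableP => //; apply: measurable_indic.
      by rewrite measurable_g_measurableTypeE.
    by move=> w; rewrite indicE; case: (_ \in _); rewrite ?normr1 ?normr0.
  have iMA := integrableZl measurableT M iA.
  have iC : P.-integrable setT (fun w => (M / 2)%:E * (W w)%:E) by exact:
    integrableZl.
  transitivity (\int[P]_w ((y w * W w)%:E - M%:E * ((\1_A w)%:E * (W w)%:E)
                 + (M / 2)%:E * (W w)%:E)); last first.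
    by apply: eq_integral => w _; rewrite -!EFinM -EFinB -EFinD; congr (_%:E);
      rewrite /y'; ring.
  have iy := bint _ _ Gy yM.
  rewrite integralD//; last exact: integrableB.
  rewrite integralB// integralZl//.
  rewrite integralZl// integral_mul_indic// !W0//.
    by rewrite !mule0 sube0 adde0.
  by have := @measurableT _ (g_sigma_algebraType G);
    rewrite measurable_g_measurableTypeE.
apply: le_trans (IH _ _ Gy' y'M) _.
by rewrite exprS invfM mulrA.
Qed.

(** Letting [k] grow in the halving estimate takes the place of an approximation of [y] by simple
    functions. *)
Lemma bounded_integral_mul_eq0 (W y : Omega -> R) M : sigma_algebra setT G ->
  G `<=` measurable -> P.-integrable setT (EFin \o W) ->
  (forall A, G A -> \int[P]_(w in A) (W w)%:E = 0) ->
  sub_measurable G y -> (forall w, `|y w| <= M)%R ->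
  \int[P]_w (y w * W w)%:E = 0.
Proof.
move=> sG Gm iW W0 Gy yM; apply/eqP; rewrite -abse_eq0 eq_le abse_ge0 andbT.
have fC := integrable_fin_num measurableT (integrable_abse iW).
pose C := fine (\int[P]_w `|(W w)%:E|).
have C0 : (0 <= C)%R by apply/fine_ge0/integral_ge0.
apply/lee_addgt0Pr => e e0; rewrite add0e.
(* The [1] keeps the denominator positive when [C] or [M] vanishes. *)
have e'0 : (0 < e / (`|M| * C + 1))%R by rewrite divr_gt0// ltr_wpDl// mulr_ge0.
have [k _ /(_ k (leqnn k))/= ke] := near_infty_natSinv_expn_lt (PosNum e'0).
apply: le_trans (bounded_integral_mul_le k sG Gm iW W0 Gy yM) _.
rewrite -(fineK fC) -EFinM lee_fin -/C.
have k0 : (0 < 1 / 2 ^+ k :> R)%R by rewrite divr_gt0// exprn_gt0.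
apply: (@le_trans _ _ ((1 / 2 ^+ k) * (`|M| * C + 1))%R).
  rewrite mulrAC mulrC mul1r ler_wpM2l// ?invr_ge0 ?exprn_ge0//.
  by rewrite ler_wpDr// ler_wpM2r// ler_norm.
by rewrite -ler_pdivlMr ?ltr_wpDl ?mulr_ge0// ltW.
Qed.

(** The difference [Y - X] integrates to zero over every event of [G], hence against every bounded
    [G]-measurable function. *)
Lemma cond_expectation_mul (X Y y : Omega -> R) : sigma_algebra setT G ->
  G `<=` measurable -> P.-integrable setT (EFin \o X) ->
  cond_expectation P G X Y -> sub_measurable G y -> y \in Lfun P +oo ->
  \int[P]_w (y w * Y w)%:E = \int[P]_w (y w * X w)%:E.
Proof.
move=> sG Gm iX [GY iY XY] Gy yoo.
have iyX := Linfty_mul_integrable yoo iX;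
  have iyY := Linfty_mul_integrable yoo iY.
have /LinftyP[my [M yM]] := yoo.
pose W w := (Y w - X w)%R.
have iW : P.-integrable setT (EFin \o W).
  rewrite (_ : EFin \o W = (EFin \o Y) \- (EFin \o X));
    first exact: integrableB.
  by apply/funext => w; rewrite /W/= EFinB.
have W0 A : G A -> \int[P]_(w in A) (W w)%:E = 0.
  move=> GA; have mA := Gm _ GA.
  have iXA : P.-integrable A (EFin \o X) by apply: integrableS iX.
  have iYA : P.-integrable A (EFin \o Y) by apply: integrableS iY.
  transitivity (\int[P]_(w in A) ((EFin \o Y) \- (EFin \o X)) w).
    by apply: eq_integral => w _; rewrite /W/= EFinB.
  by rewrite integralB// XY// subee// integrable_fin_num.
(* [y] is only essentially bounded. Cutting by its value keeps it [G]-measurable even if [G] does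
   not contain the exceptional null set. *)
pose y' w := if (`|y w| <= M)%R then y w else 0%R.
have Gy' : sub_measurable G y'.
  apply/sub_measurableP => //; have /(sub_measurableP _ sG) my' := Gy.
  by apply: measurable_fun_ifT => //; apply: measurable_fun_ler => //;
    apply: measurableT_comp.
have y'M w : (`|y' w| <= `|M|)%R.
  by rewrite /y'; case: ifPn => [/le_trans->//|_]; rewrite ?ler_norm ?normr0.
have my'W : measurable_fun setT (fun w => (y' w * W w)%:E).
  apply/measurable_EFinP; apply: measurable_funM.
    exact: sub_measurable_measurable Gy'.
  by apply/measurable_EFinP; exact: measurable_int iW.
suff : \int[P]_w (y w * Y w)%:E - \int[P]_w (y w * X w)%:E = 0.
  rewrite -(fineK (integrable_fin_num measurableT iyX)).
  rewrite -(fineK (integrable_fin_num measurableT iyY)) -EFinB.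
  by move=> [/eqP]; rewrite subr_eq0 => /eqP ->.
rewrite -integralB//.
rewrite -(bounded_integral_mul_eq0 sG Gm iW W0 Gy' y'M).
apply: ae_eq_integral => //.
  exact: measurable_int (integrableB measurableT iyY iyX).
apply: filterS yM => w yM _ /=.
by rewrite -EFinB /y' yM /W mulrBr.
Qed.

End ConditionalExpectation.

(** * Duality and subdifferentials *)

Section Duality.
Context (d : measure_display) (Omega : measurableType d) (R : realType).
Context (P : probability Omega R) (T : nat).
Context (F : 'I_T.+1 -> set (set Omega)) (n_ : 'I_T.+1 -> nat).
Local Notation n := (\sum_(t < T.+1) n_ t)%N.
Context (f : 'rV[R]_n -> Omega -> \bar R).
Context (filtF : filtration F) (nf : normal_integrand f)
  (pf : proper_on_Linfty P f).
Implicit Types x z v xs : Omega -> 'rV[R]_n.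

Lemma componentE x t (i : 'I_(n_ t)) w :
  component x i w = x w ord0 (tagnat.Rank t i).
Proof. by rewrite /component mxE. Qed.

Lemma Ninfty0 : Ninfty P F n_ (cst 0%R).
Proof.
split; last exact: Lvec_infty0.
move=> t i; apply/sub_measurableP; first by case: filtF.
by rewrite (_ : component _ _ = cst 0%R)//; apply/funext => w;
  rewrite componentE mxE.
Qed.

Lemma NinftyZ k z : Ninfty P F n_ z -> Ninfty P F n_ (fun w => k *: z w)%R.
Proof.
move=> [az zoo]; split; last exact: Lvec_inftyZ.
have [sF _ _] := filtF; move=> t i; apply/sub_measurableP => //.
rewrite (_ : component _ _ = fun w => (k * component z i w)%R).
  by apply: measurable_funM => //; exact/sub_measurableP.
by apply/funext => w; rewrite !componentE mxE.
Qed.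

(** The delicate case is [Ef P f y = +oo]: an integrable positive part of the difference, plus the
    integrable [|dotp y xs|], would dominate [f(y)] and force [Ef] below [+oo]. *)
Lemma Ef_sub_pairing y xs : Lvec P +oo y -> Lvec P 1 xs ->
  Eext P (fun w => f (y w) w - (dotp (y w) (xs w))%:E) =
  Ef P f y - pairing P y xs.
Proof.
move=> yoo xs1; have iyxs := dotp_integrable yoo xs1.
have mfy : measurable_fun setT (fun w => f (y w) w).
  by apply: measurable_integrand => // j; exact: Lvec_measurable yoo.
have [fyy|fy] := eqVneq (Ef P f y) +oo; last first.
  have iy := Ef_integrable nf pf yoo (ltac:(by rewrite ltey)).
  rewrite Eext_integrable; last exact: integrableB.
  by rewrite integralB// /Ef Eext_integrable// pairingE.
rewrite fyy addye; last by rewrite -(fineK (pairing_fin_num yoo xs1)).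
rewrite /Eext; case: asboolP => // ih; exfalso.
have := integrable_lty measurableT (integrableD measurableT ih (integrable_abse
  iyxs)).
rewrite ltNge => /negP; apply; rewrite -fyy; apply: Eext_le => //.
  exact: integrableD ih (integrable_abse iyxs).
apply: nearW => w /=.
rewrite -leeBlDr//; apply: le_trans (_ : _ <= f (y w) w - (dotp (y w) (xs
  w))%:E) _.
  by rewrite leeB// lee_fin ler_norm.
exact: (@le_funepos _ _ _ (fun w => f (y w) w - (dotp (y w) (xs w))%:E)).
Qed.

Lemma phi_tilde_le xs x z : Lvec P 1 xs -> Lvec P +oo z -> Ninfty P F n_ x ->
  phi_tilde P F f xs z <= Ef P f (fun w => x w + z w)%R
                          - pairing P (fun w => x w + z w)%R xs.
Proof.
move=> xs1 zoo xN; rewrite -Ef_sub_pairing//; last by apply: LvecD xN.2 zoo;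
  exact: leey.
by apply: ereal_inf_lbound; exists x.
Qed.

Lemma le_phi_tilde xs z b : Lvec P 1 xs -> Lvec P +oo z ->
  (forall x, Ninfty P F n_ x -> b <= Ef P f (fun w => x w + z w)%R
                          - pairing P (fun w => x w + z w)%R xs) ->
  b <= phi_tilde P F f xs z.
Proof.
move=> xs1 zoo h; apply: le_ereal_inf_tmp => _ [x xN <-].
by rewrite Ef_sub_pairing//; [exact: h|apply: LvecD xN.2 zoo; exact: leey].
Qed.

Lemma phi_tilde0 xs : Lvec P 1 xs -> phi_tilde P F f xs (cst 0%R) = - Ef_conj P
  F f xs.
Proof.
move=> xs1; have add0 x : (fun w => x w + cst 0 w)%R = x by apply/funext => w;
  rewrite addr0.
have zoo := @Lvec_infty0 _ _ _ P n.
apply/eqP; rewrite eq_le; apply/andP; split.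
  rewrite leeNr; apply: ge_ereal_sup => _ [x xN <-]; rewrite leeNr.
  have := phi_tilde_le xs1 zoo xN; rewrite add0 => /le_trans; apply.
  by rewrite -(fineK (pairing_fin_num xN.2 xs1)) oppe_subl.
apply: le_phi_tilde => // x xN; rewrite add0 leeNl.
apply: ereal_sup_ubound; exists x => //.
by rewrite -(fineK (pairing_fin_num xN.2 xs1)) -oppe_subl oppeK.
Qed.

(** For adapted [x], orthogonality makes the pairings of [z] and of [x + z] with [v] equal, so the
    two suprema merge into one over L^infty. The reverse inequality takes [x = 0] in the infimum. *)
Lemma conj_phi_tilde xs v : Lvec P 1 xs -> Nperp P F n_ v ->
  conj_Linfty P (phi_tilde P F f xs) v =
  Ef P (conj_integrand f) (fun w => xs w + v w)%R.
Proof.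
move=> xs1 [v1 vN]; have xsv1 : Lvec P 1 (fun w => xs w + v w)%R by exact:
  LvecD.
rewrite Ef_conj_integrand//; apply/eqP; rewrite eq_le; apply/andP; split.
  apply: ge_ereal_sup => _ [z zoo <-].
  rewrite -(fineK (pairing_fin_num zoo v1)); apply: lee_subl_swap.
  apply: le_phi_tilde => // x xN; set y := (fun w => x w + z w)%R.
  have yoo : Lvec P +oo y by apply: LvecD xN.2 zoo; exact: leey.
  apply: lee_subl_swap.
  apply: le_trans (_ : pairing P y (fun w => xs w + v w)%R - Ef P f y <= _);
    last first.
    by apply: ereal_sup_ubound; exists y.
  rewrite pairingDr// [pairing P y v]pairingDl//; last exact: xN.2.
  rewrite (vN _ xN) add0e -(fineK (pairing_fin_num yoo xs1)) -(fineK
    (pairing_fin_num zoo v1)).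
  by rewrite sube_subr lexx.
apply: ge_ereal_sup => _ [y yoo <-].
apply: le_trans (_ : pairing P y v - phi_tilde P F f xs y <= _); last first.
  by apply: ereal_sup_ubound; exists y.
have := phi_tilde_le xs1 yoo Ninfty0.
rewrite (_ : (fun w => cst 0 w + y w)%R = y); last by apply/funext => w;
  rewrite add0r.
rewrite pairingDr// -(fineK (pairing_fin_num yoo xs1)) -(fineK (pairing_fin_num
  yoo v1)).
move=> /(@leeB _ (fine (pairing P y v))%:E _ _ _ (lexx _)); apply: le_trans.
by rewrite sube_subr lexx.
Qed.

(** Moving a point [y0] of the domain along an adapted [z] not orthogonal to [v] leaves the upper
    bound on [phi_tilde] fixed, because the infimum absorbs the shift, while the pairing with [v] is
    unbounded. *)
Lemma conj_phi_tilde_notin_Nperp xs v : Lvec P 1 xs -> Lvec P 1 v ->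
  ~ Nperp P F n_ v -> conj_Linfty P (phi_tilde P F f xs) v = +oo.
Proof.
move=> xs1 v1 vN.
have [z [zN pz0]] : exists z, Ninfty P F n_ z /\ pairing P z v != 0.
  apply: contrapT => nz; apply: vN; split => // z zN;
    apply/eqP/negPn/negP => pz.
  by apply: nz; exists z.
have [y0 y0oo fy0] := pf.2.
have fin_y0 : Ef P f y0 \is a fin_num.
  by rewrite fin_numElt fy0 andbT; exact: pf.1.
have fz := pairing_fin_num zN.2 v1.
have fp1 := pairing_fin_num y0oo v1; have fp2 := pairing_fin_num y0oo xs1.
pose p := fine (pairing P z v).
have p0 : p != 0%R by rewrite -eqe fineK.
apply/eqyP => a _.
(* Solves for the step at which the lower bound on the conjugate equals the prescribed [a]. *)
pose k := ((fine (pairing P y0 v) - fine (Ef P f y0) + fine (pairing P y0 xs) -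
  a) / p)%R.
have kzN := NinftyZ k zN.
have zoo : Lvec P +oo (fun w => y0 w - k *: z w)%R by apply: Lvec_inftyB => //;
  exact: kzN.2.
apply: le_trans (ereal_sup_ubound _); last first.
  exists (fun w => y0 w - k *: z w)%R => //.
have := phi_tilde_le xs1 zoo kzN.
rewrite (_ : (fun w => k *: z w + (y0 w - k *: z w))%R = y0); last first.
  by apply/funext => w; rewrite addrC subrK.
rewrite pairingBl//; last exact: kzN.2.
rewrite pairingZl//; last exact: zN.2.
rewrite -(fineK fin_y0) -(fineK fp1) -(fineK fp2) -(fineK fz) -EFinM -!EFinB.
move=> /(@leeB _ (fine (pairing P y0 v) - k * p)%:E _ _ _ (lexx _));
  apply: le_trans.
by rewrite -EFinB lee_fin /k divfK//; lra.
Qed.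

(** The term [z = 0] in the supremum defining the conjugate of [phi_tilde]. *)
Lemma weak_duality xs v : Lvec P 1 xs -> Nperp P F n_ v ->
  Ef_conj P F f xs <= Ef P (conj_integrand f) (fun w => xs w + v w)%R.
Proof.
move=> xs1 vN; rewrite -conj_phi_tilde//.
apply: ereal_sup_ubound; exists (cst 0%R); first exact: Lvec_infty0.
by rewrite pairing0l phi_tilde0// add0e oppeK.
Qed.

(** At the origin the pairing vanishes, and any [v] outside N^perp contributes [-oo] to the
    supremum. *)
Lemma biconj_phi_tilde0 xs : Lvec P 1 xs ->
  biconj_Linfty P (phi_tilde P F f xs) (cst 0%R) =
  - ereal_inf [set Ef P (conj_integrand f) (fun w => xs w + v w)%R
              | v in Nperp P F n_].
Proof.
move=> xs1; apply/eqP; rewrite eq_le; apply/andP; split.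
  apply: ge_ereal_sup => _ [v v1 <-]; rewrite pairing0l add0e leeN2.
  have [vN|vN] := pselect (Nperp P F n_ v).
    by rewrite conj_phi_tilde//; apply: ereal_inf_lbound; exists v.
  by rewrite conj_phi_tilde_notin_Nperp// leey.
rewrite leeNl; apply: le_ereal_inf_tmp => _ [v vN <-]; rewrite leeNl.
apply: ereal_sup_ubound; exists v; first exact: vN.1.
by rewrite pairing0l add0e conj_phi_tilde.
Qed.

(** A subgradient [v] at the origin bounds the conjugate at [v] by [- phi_tilde(0)]. This is finite,
    which forces [v] into N^perp, and weak duality closes the gap. *)
Lemma attained_duality xs : Lvec P 1 xs ->
  subdifferentiable_at_origin P (phi_tilde P F f xs) ->
  exists2 v, Nperp P F n_ v &
    Ef P (conj_integrand f) (fun w => xs w + v w)%R = Ef_conj P F f xs.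
Proof.
move=> xs1 [fin0 [v v1 sub]].
have cle : conj_Linfty P (phi_tilde P F f xs) v <= Ef_conj P F f xs.
  apply: ge_ereal_sup => _ [z zoo <-].
  rewrite -(fineK (pairing_fin_num zoo v1)); apply: lee_subl_swap.
  apply: le_trans (sub _ zoo); rewrite phi_tilde0// addeC.
  by rewrite fineK// pairing_fin_num.
have vN : Nperp P F n_ v.
  apply: contrapT => vN; move: cle fin0.
  by rewrite conj_phi_tilde_notin_Nperp// leye_eq phi_tilde0// => /eqP ->.
exists v => //; apply/eqP; rewrite eq_le weak_duality// andbT.
by rewrite -conj_phi_tilde.
Qed.
End Duality.

Lemma ae_eq_of_integral_le (d : measure_display) (Omega : measurableType d)
    (R : realType) (P : probability Omega R) (p q : Omega -> \bar R) :
  P.-integrable setT p -> P.-integrable setT q -> (forall w, q w <= p w) ->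
  \int[P]_w p w <= \int[P]_w q w -> {ae P, forall w, p w = q w}.
Proof.
move=> ip iq qp pq.
have ipq := integrableB measurableT ip iq.
have fp := integrable_fin_num measurableT ip.
have fq := integrable_fin_num measurableT iq.
have /(ae_eq_integral_abs _ measurableT (measurable_int _ ipq)) pq0 :
    \int[P]_w `|(p \- q) w| = 0.
  apply/eqP; rewrite eq_le integral_ge0 ?andbT//.
  rewrite (@ae_eq_integral _ _ _ P setT (p \- q))//.
  - by rewrite integralB// sube_le0.
  - by apply: measurableT_comp => //; exact: measurable_int ipq.
  - exact: measurable_int ipq.
  - apply: filterS (integrable_ae measurableT iq) => w /(_ I) qw _ /=.
    by rewrite gee0_abs// sube_ge0 ?qw ?qp.
apply: filterS3 pq0 (integrable_ae measurableT ip) (integrable_ae measurableT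
  iq).
move=> w /(_ I) /= + /(_ I) pw /(_ I) qw.
rewrite -(fineK pw) -(fineK qw) -EFinB => -[/eqP].
by rewrite subr_eq0 => /eqP ->.
Qed.

Lemma conjugate_le_subdifferential (R : realType) (n : nat)
    (h : 'rV[R]_n -> \bar R) (xi v : 'rV[R]_n) : h xi \is a fin_num ->
  conjugate h v <= (dotp xi v)%:E - h xi -> subdifferential h xi v.
Proof.
move=> hxi cle; split=> // xi'.
have := le_trans (fenchel_young h xi' v) cle.
rewrite -(fineK hxi) dotpBl; case: (h xi') => [r| |]//.
- by rewrite -!(EFinB, EFinD) !lee_fin; lra.
- by move=> _; exact: leey.
Qed.

(** * The two inclusions between the subdifferentials *)

Section Subdifferential.
Context (d : measure_display) (Omega : measurableType d) (R : realType).
Context (P : probability Omega R) (T : nat).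
Context (F : 'I_T.+1 -> set (set Omega)) (n_ : 'I_T.+1 -> nat).
Local Notation n := (\sum_(t < T.+1) n_ t)%N.
Context (f : 'rV[R]_n -> Omega -> \bar R).
Context (filtF : filtration F) (nf : normal_integrand f)
  (pf : proper_on_Linfty P f).
Implicit Types x z v xs : Omega -> 'rV[R]_n.

Lemma component_integrable v t (i : 'I_(n_ t)) : Lvec P 1 v ->
  P.-integrable setT (EFin \o component v i).
Proof.
move=> v1; rewrite (_ : component v i = fun w => v w ord0 (tagnat.Rank t i)).
  by apply/Lfun1_integrable; exact: v1.
by apply/funext => w; rewrite componentE.
Qed.

(** Elements of N^perp have zero adapted projection: the indicator of an event of [F t], placed in
    one coordinate of stage [t], is a bounded adapted process. *)
Lemma adapted_projectionD_Nperp xs v : N1 P F n_ xs -> Nperp P F n_ v ->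
  adapted_projection P F (fun w => xs w + v w)%R xs.
Proof.
have [sF Fm _] := filtF.
move=> [axs xs1] [v1 vN] t i; split.
- exact: axs.
- exact: component_integrable.
move=> A FA; have mA := Fm _ _ FA.
have iv := component_integrable i v1; have ixs := component_integrable i xs1.
have ivA : P.-integrable A (EFin \o component v i) by apply: integrableS iv.
have ixsA : P.-integrable A (EFin \o component xs i) by apply: integrableS ixs.
transitivity (\int[P]_(w in A) ((component xs i w)%:E + (component v i w)%:E));
  last first.
  by apply: eq_integral => w _; rewrite -EFinD !componentE mxE.
rewrite integralD//= [X in _ = _ + X](_ : _ = 0) ?adde0//.
pose z w : 'rV[R]_n := \row_j (if j == tagnat.Rank t i then \1_A w else 0)%R.
have zN : Ninfty P F n_ z.
  split=> [s k|j].
    apply/sub_measurableP => //.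
    have [e|ne] := eqVneq (tagnat.Rank s k) (tagnat.Rank t i).
      have -> : component z k = \1_A.
        by apply/funext => w; rewrite componentE mxE e eqxx.
      apply: measurable_indic; rewrite measurable_g_measurableTypeE//.
      move/(congr1 val)/eqP : e; rewrite /= tagnat.eq_Rank => /andP[/eqP st _].
      by rewrite st.
    have -> : component z k = cst 0%R.
      by apply/funext => w; rewrite componentE mxE (negbTE ne).
    exact: measurable_cst.
  apply/LinftyP; split.
    have [e|ne] := eqVneq j (tagnat.Rank t i).
      rewrite (_ : (fun _ => _) = \1_A); first exact: measurable_indic.
      by apply/funext => w; rewrite mxE e eqxx.
    rewrite (_ : (fun _ => _) = cst 0%R)//.
    by apply/funext => w; rewrite mxE (negbTE ne).
  exists 1%R; apply: nearW => w; rewrite mxE indicE.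
  by case: ifP => _; [case: (_ \in _)|]; rewrite ?normr1 ?normr0.
rewrite -(vN _ zN) pairingE -integral_mul_indic//; apply: eq_integral => w _.
rewrite -EFinM /dotp (bigD1 (tagnat.Rank t i))//= [X in (_ + X)%R]big1 ?addr0;
  last first.
  by move=> j jti; rewrite mxE (negbTE jti) mul0r.
by rewrite mxE eqxx componentE.
Qed.

Lemma adapted_projection_Lvec v u : adapted_projection P F v u -> Lvec P 1 u.
Proof.
move=> vu j; rewrite -(tagnat.sig2K j); apply/Lfun1_integrable.
have [_ + _] := vu (tagnat.sig1 j) (tagnat.sig2 j).
by congr integrable; apply/funext => w; rewrite /= componentE.
Qed.

(** Flat coordinates [j] are read as pairs [(t, i)]; each component of [x] is then [F t]-measurable
    and essentially bounded, so it can be integrated against the conditional expectation. *)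
Lemma pairing_adapted_projection x v u : Ninfty P F n_ x -> Lvec P 1 v ->
  adapted_projection P F v u -> pairing P x u = pairing P x v.
Proof.
have [sF Fm _] := filtF.
move=> [ax xoo] v1 vu; have u1 := adapted_projection_Lvec vu.
have pairing_sum v' : Lvec P 1 v' ->
    pairing P x v' = \sum_(j < n) \int[P]_w (x w ord0 j * v' w ord0 j)%:E.
  move=> v'1; rewrite pairingE -integral_sum//.
    by apply: eq_integral => w _; rewrite sumEFin.
  move=> j; apply: Linfty_mul_integrable; first exact: xoo.
  by apply/Lfun1_integrable; exact: v'1.
rewrite !pairing_sum//; apply: eq_bigr => j _; rewrite -(tagnat.sig2K j).
set t := tagnat.sig1 j; set i := tagnat.sig2 j.
have cE (y : Omega -> 'rV[R]_n) : (fun w => y w ord0 (tagnat.Rank t i)) =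
  component y i.
  by apply/funext => w; rewrite componentE.
have := @cond_expectation_mul _ _ _ P (F t) (component v i) (component u i)
  (component x i) (sF t) (Fm t) (component_integrable i v1) (vu t i) (ax t i).
rewrite -!cE; apply; exact: xoo.
Qed.

Lemma Ef_subdiff_sub x : Ninfty P F n_ x ->
  (forall xs, Ef_subdiff P F f x xs ->
     subdifferentiable_at_origin P (phi_tilde P F f xs)) ->
  Ef_subdiff P F f x `<=` aL1_subdiff P F f x.
Proof.
move=> xN sub xs xsx; have [xsN fin_x xs_sub] := xsx.
have [v vN vE] := attained_duality filtF nf pf xsN.2 (sub _ xsx).
pose u w := (xs w + v w)%R.
exists u; last exact: adapted_projectionD_Nperp.
have u1 : Lvec P 1 u by apply: LvecD => //; [exact: xsN.2|exact: vN.1].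
split=> //.
have fxs := pairing_fin_num xN.2 xsN.2.
have ix : P.-integrable setT (fun w => f (x w) w).
  by apply: Ef_integrable xN.2 _ => //; move: fin_x;
    rewrite fin_numElt => /andP[].
have iq := integrableB measurableT (dotp_integrable xN.2 u1) ix.
have qE : \int[P]_w ((dotp (x w) (u w))%:E - f (x w) w) = pairing P x xs - Ef P
  f x.
  rewrite integralB//; last exact: (dotp_integrable xN.2 u1).
  rewrite -pairingE pairingDr//; [|exact: xN.2|exact: xsN.2|exact: vN.1].
  by rewrite vN.2// adde0 /Ef Eext_integrable.
(* By the choice of [v] the left side is [Ef_conj], and the subgradient inequality bounds each term
   of its supremum. *)
have Eu : Ef P (conj_integrand f) u <= pairing P x xs - Ef P f x.
  rewrite vE; apply: ge_ereal_sup => _ [x' x'N <-].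
  have := xs_sub _ x'N; rewrite pairingBl//;
    [|exact: x'N.2|exact: xN.2|exact: xsN.2].
  rewrite -(fineK fxs) -(fineK (pairing_fin_num x'N.2 xsN.2)) -(fineK fin_x).
  case: (Ef P f x') => [r| |]//.
  - by rewrite -!(EFinB, EFinD) !lee_fin; lra.
  - by move=> _; exact: leNye.
have mp : measurable_fun setT (fun w => conj_integrand f (u w) w).
  by apply: measurable_conj_integrand => // j; exact: Lvec_measurable u1.
have ip : P.-integrable setT (fun w => conj_integrand f (u w) w).
  apply: Eext_fin_integrable => //.
    apply: (@lt_le_trans _ _ (pairing P x xs - Ef P f x)).
      by rewrite -(fineK fxs) -(fineK fin_x) -EFinB ltNyr.
    by rewrite -qE; apply: ge_Eext => //; apply: nearW => w;
      exact: fenchel_young.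
  by apply: le_lt_trans Eu _; rewrite -(fineK fxs) -(fineK fin_x) -EFinB ltry.
have := ae_eq_of_integral_le ip iq (fun w => fenchel_young _ _ _).
rewrite qE -[X in X <= _]Eext_integrable// => /(_ Eu) pq.
apply: filterS2 pq (integrable_ae measurableT ix) => w pq /(_ I) fxw.
by apply: conjugate_le_subdifferential => //; rewrite -pq.
Qed.

(** Membership of [v] in the pointwise subdifferential, tested at [x0], bounds [f(x)] above by the
    integrable [f(x0) - (x0 - x).v]; this is what makes [Ef] finite at [x]. *)
Lemma aL1_subdiff_sub x : (exists2 x0, Ninfty P F n_ x0 & Ef P f x0 < +oo) ->
  Ninfty P F n_ x -> aL1_subdiff P F f x `<=` Ef_subdiff P F f x.
Proof.
move=> [x0 x0N fx0] xN u [v [v1 vsub] vu].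
have u1 := adapted_projection_Lvec vu.
have mx : measurable_fun setT (fun w => f (x w) w).
  by apply: measurable_integrand => // j; exact: Lvec_measurable xN.2.
have xNy : -oo < Ef P f x by apply: pf.1; exact: xN.2.
have ix : P.-integrable setT (fun w => f (x w) w).
  apply: (Eext_fin_integrable mx xNy).
  have ix0 := Ef_integrable nf pf x0N.2 fx0.
  have ig := integrableB measurableT ix0
    (dotp_integrable (Lvec_inftyB x0N.2 xN.2) v1).
  apply: le_lt_trans (integrable_lty measurableT ig); apply: Eext_le => //.
  by apply: filterS vsub => w [fxw /(_ (x0 w))]; rewrite -leeBrDr.
have fin_x : Ef P f x \is a fin_num.
  by rewrite /Ef Eext_integrable//; exact: integrable_fin_num.
split=> //; first by split=> // t i; have [] := vu t i.
move=> x' x'N; have fv := dotp_integrable (Lvec_inftyB x'N.2 xN.2) v1.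
(* The pairing is split so that [u] is exchanged for [v] at the adapted [x'] and [x] separately,
   then reassembled. *)
rewrite pairingBl//; [|exact: x'N.2|exact: xN.2].
rewrite !(pairing_adapted_projection _ v1 vu)// -pairingBl//;
  [|exact: x'N.2|exact: xN.2].
rewrite /Ef Eext_integrable// pairingE -integralD//.
apply: ge_Eext.
- by apply: measurable_integrand => // j; exact: Lvec_measurable x'N.2.
- exact: integrableD.
- by apply: filterS vsub => w [_ ]; exact.
Qed.
End Subdifferential.

Theorem theorem7 (d : measure_display) (Omega : measurableType d)
    (R : realType) (P : probability Omega R) (T : nat)
    (F : 'I_T.+1 -> set (set Omega)) (n_ : 'I_T.+1 -> nat)
    (f : 'rV[R]_(\sum_(t < T.+1) n_ t)%N -> Omega -> \bar R) :
  filtration F ->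
  normal_integrand f ->
  proper_on_Linfty P f ->
  (exists2 x, Ninfty P F n_ x & Ef P f x < +oo) ->
  [/\ (forall xs, N1 P F n_ xs ->
         closed_at_origin P (phi_tilde P F f xs) ->
         Ef_conj P F f xs =
         ereal_inf [set Ef P (conj_integrand f) (fun w => xs w + v w)%R
                   | v in Nperp P F n_]),
      (forall xs, N1 P F n_ xs ->
         subdifferentiable_at_origin P (phi_tilde P F f xs) ->
         exists2 v, Nperp P F n_ v &
           Ef P (conj_integrand f) (fun w => xs w + v w)%R =
           ereal_inf [set Ef P (conj_integrand f) (fun w => xs w + v' w)%R
                     | v' in Nperp P F n_]) &
      (forall x, Ninfty P F n_ x ->
         (forall xs, Ef_subdiff P F f x xs ->
            subdifferentiable_at_origin P (phi_tilde P F f xs)) ->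
         Ef_subdiff P F f x = aL1_subdiff P F f x)].
Proof.
move=> filtF nf pf dom; split.
- move=> xs [_ xs1]; rewrite /closed_at_origin phi_tilde0// biconj_phi_tilde0//.
  by move/oppe_inj.
- move=> xs [_ xs1] /(attained_duality filtF nf pf xs1)[v vN vE].
  exists v => //; apply/eqP; rewrite eq_le; apply/andP; split; last first.
    by apply: ereal_inf_lbound; exists v.
  apply: le_ereal_inf_tmp => _ [v' v'N <-]; rewrite vE.
  exact: weak_duality.
- move=> x xN sub; apply/seteqP; split; first exact: Ef_subdiff_sub.
  exact: aL1_subdiff_sub.
Qed.
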